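(* Let $\Gamma$ be a compact tree, and let $v$ be an arbitrary leaf of $\Gamma$. Let $\lambda_1(\Gamma)$ be the first eigenvalue of the Laplacian on $\Gamma$ with Dirichlet conditions at all leaves and Kirchhoff conditions at all other vertices, and let $\tau_1(\Gamma)$ be the first eigenvalue of the Laplacian on $\Gamma$ with a Neumann condition at the single leaf $v$, Dirichlet conditions at all remaining leaves, and Kirchhoff conditions at all other vertices. Then $$\frac{\lambda_1(\Gamma)}{\tau_1(\Gamma)}\le 4,$$ with equality if and only if $\Gamma$ is an interval.
   Context: A compact metric graph $\Gamma=(\mathcal V,\mathcal E)$ has finitely many vertices and edges; each edge $e$ is identified with an interval $[0,\ell_e]$, $0<\ell_e<\infty$, whose endpoints are attached to vertices; $\Gamma$ is connected. It is a tree if $|\mathcal E|-|\mathcal V|+1=0$. A leaf is a vertex of degree one. Vertices of degree two are regarded as suppressed (inserting or deleting a degree-two vertex with Kirchhoff conditions does not change the graph or its operator). $C(\Gamma)$ denotes the continuous functions on $\Gamma$ and $H^1(\Gamma)=\{f\in C(\Gamma): f|_e\in H^1(e)\ \forall e\in\mathcal E\}$. For a finite set $V_D$ of vertices, the Laplacian on $\Gamma$ with Dirichlet conditions at $V_D$ is the self-adjoint operator on $L^2(\Gamma)$ associated with the form $\int_\Gamma f'\overline{g}'\,dx$ on the set of $f\in H^1(\Gamma)$ vanishing on $V_D$. It acts as $-f''$ on each edge; functions in its domain vanish on $V_D$ and satisfy at all other vertices the Kirchhoff condition (continuity, and the sum of the derivatives along all incident edges, all oriented into the vertex, is zero), which at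 a leaf is the Neumann condition. Thus $\lambda_1(\Gamma)$ corresponds to $V_D=\{\text{all leaves}\}$ and $\tau_1(\Gamma)$ to $V_D=\{\text{all leaves except } v\}$. *)

(* Defs.v *)
From HB Require Import structures.
From mathcomp Require Import all_boot all_order all_algebra.
From mathcomp Require Import all_classical all_reals all_analysis.
From mathcomp Require Export complex.
Set Implicit Arguments.
Unset Strict Implicit.
Unset Printing Implicit Defensive.
Import Order.TTheory GRing.Theory Num.Theory numFieldNormedType.Exports.
Local Open Scope classical_set_scope.
Local Open Scope ring_scope.
Local Open Scope complex_scope.

(* Loops and multiple edges are allowed, and so are vertices of degree two;
   the orientation src -> tgt only fixes the coordinate x in [0, len e]. *)
Record metric_graph (R : realType) := MetricGraph {
  vertex : finType;
  edge : finType;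
  src : edge -> vertex;
  tgt : edge -> vertex;
  len : edge -> R;
  len_gt0 : forall e, 0 < len e;
  graph_connected : forall u w : vertex,
    connect (fun a b => [exists e, ((src e == a) && (tgt e == b))
                                || ((src e == b) && (tgt e == a))]) u w
}.

Arguments src {R m}.
Arguments tgt {R m}.
Arguments len {R m}.

Section MetricGraph.
Context (R : realType).
Implicit Types G : metric_graph R.

(* |E| - |V| + 1 = 0, without subtraction *)
Definition is_tree G := #|vertex G| = #|edge G|.+1.

(* a loop counts twice *)
Definition degree G (w : vertex G) : nat :=
  (#|[set e : edge G | src e == w]%SET| + #|[set e : edge G | tgt e == w]%SET|)%N.

Definition leaf G (w : vertex G) : bool := degree w == 1%N.

Definition leaves G : {set vertex G} := [set w | leaf w]%SET.

(* A point of the graph is given by an edge e and a coordinate x in [0, len e],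
   up to same_point. *)
Definition endpoint G (e : edge G) (x : R) (w : vertex G) : Prop :=
  (x = 0 /\ src e = w) \/ (x = len e /\ tgt e = w).

Definition same_point G (e : edge G) (x : R) (e' : edge G) (x' : R) : Prop :=
  (e = e' /\ x = x') \/ exists w, endpoint e x w /\ endpoint e' x' w.

(* phi is an arc-length preserving bijection from the graph onto [0, L].
   Being stated on points, this does not depend on whether vertices of degree
   two are suppressed. *)
Definition graph_is_interval G : Prop :=
  exists (L : R) (phi : edge G -> R -> R),
    [/\ 0 < L,
        forall e, {in `[0, len e] &, forall x y : R, `|phi e x - phi e y| = `|x - y|},
        forall e e' (x x' : R), x \in `[0, len e] -> x' \in `[0, len e'] ->
          (phi e x = phi e' x' <-> same_point e x e' x') &
        forall t : R, t \in `[0, L] <->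
          exists e (x : R), x \in `[0, len e] /\ phi e x = t].

(* Only the values f e x with x in [0, len e] are meaningful. *)
Definition graph_fun G := edge G -> R -> R[i].

Definition cintegral (D : set R) (h : R -> R[i]) : R[i] :=
  (\int[lebesgue_measure]_(x in D) complex.Re (h x)) +i*
  (\int[lebesgue_measure]_(x in D) complex.Im (h x)).

(* h restricted to [0, l] is in L^2(0, l); \_ is extension by 0. *)
Definition L2_itv (l : R) (h : R -> R[i]) : Prop :=
  (((fun x : R => complex.Re (h x)) \_ `[0, l]) \in Lfun lebesgue_measure 2%:E) /\
  (((fun x : R => complex.Im (h x)) \_ `[0, l]) \in Lfun lebesgue_measure 2%:E).

(* h is the absolutely continuous representative of an element of H^1(0, l),
   with derivative dh (unique up to a null set). *)
Definition H1_deriv_itv (l : R) (h dh : R -> R[i]) : Prop :=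
  L2_itv l dh /\
  forall x : R, x \in `[0, l] -> h x = h 0 + cintegral `[0, x] dh.

Definition in_L2 G (f : graph_fun G) : Prop := forall e, L2_itv (len e) (f e).

Definition graph_continuous G (f : graph_fun G) : Prop :=
  (forall e, {within `[0, len e], continuous (f e : R -> R[i]^o)}) /\
  forall e e' (x x' : R), x \in `[0, len e] -> x' \in `[0, len e'] ->
    same_point e x e' x' -> f e x = f e' x'.

(* f belongs to H^1 of the graph and df is its edgewise derivative. *)
Definition H1_deriv G (f df : graph_fun G) : Prop :=
  graph_continuous f /\ forall e, H1_deriv_itv (len e) (f e) (df e).

Definition vanishes_on G (VD : {set vertex G}) (f : graph_fun G) : Prop :=
  forall w e x, w \in VD -> endpoint e x w -> f e x = 0.

Definition L2_inner G (f g : graph_fun G) : R[i] :=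
  \sum_(e : edge G) cintegral `[0, len e] (fun x => f e x * (g e x)^*).

(* The graph of the operator associated with the form L2_inner f' g' on the
   functions of H^1 vanishing on VD: f is in the domain and is mapped to h. *)
Definition laplacian G (VD : {set vertex G}) (f h : graph_fun G) : Prop :=
  vanishes_on VD f /\ in_L2 h /\
  exists df, H1_deriv f df /\
    forall g dg, H1_deriv g dg -> vanishes_on VD g ->
      L2_inner df dg = L2_inner h g.

Definition graph_eigenvalue G (VD : {set vertex G}) (mu : R) : Prop :=
  exists f : graph_fun G,
    (exists e (x : R), x \in `[0, len e] /\ f e x != 0) /\
    laplacian VD f (fun e x => mu%:C * f e x).

(* The operator is self-adjoint, so that only real eigenvalues matter. *)
Definition graph_first_eigenvalue G (VD : {set vertex G}) (mu : R) : Prop :=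
  graph_eigenvalue VD mu /\ forall nu, graph_eigenvalue VD nu -> mu <= nu.

End MetricGraph.

(* Main.v *)
(* Let phi be an eigenfunction for tau1 = k^2, let d be the distance from v and
   r = min (k d, pi / 2). The function f = phi sin r vanishes at all leaves.
   Where k d < pi / 2, the expression f'^2 - 4 k^2 f^2 equals
   (phi phi' + k phi^2 sin 2r)' - (phi' cos r + k phi sin r)^2, in which the
   square is constant on each edge; elsewhere it is (phi phi')' - 3 k^2 phi^2.
   Summed over the edges, phi phi' cancels by the Kirchhoff conditions and
   k phi^2 sin 2r contributes a nonpositive amount at each branching vertex.

   In the other direction, shoot solutions of w'' = - K^2 w from the leaves
   towards v, matched in logarithmic derivative at the vertices. They stay
   positive for small K, and the first K at which positivity fails is a
   Dirichlet frequency. If it is not below 2 k, then for all K < 2 k Jacobi's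
   inequality with the positive solutions bounds the integral of
   f'^2 - K^2 f^2 from below by 0. Letting K tend to 2 k shows that every term
   dropped above is zero, so that phi is a multiple of cos (k d) and the tree
   does not branch. On an interval both frequencies are explicit. *)

(* A first eigenvalue is given only as an eigenvalue below all others, with no variational
   principle, so an upper bound for it must come from an actual eigenfunction. Hence shooting
   replaces the Rayleigh quotient, and the test function enters only through Jacobi's inequality.
   All of this happens on finite data: for a nonempty Dirichlet set, the eigenvalues are the squares
   of the [k > 0] for which [trig_system] has a nontrivial solution.

   The test function copies the interval, where phi = cos k x and phi sin k x is half of the
   Dirichlet eigenfunction sin 2 k x. The radius stops at pi / 2 because sin 2r has to stay
   nonnegative at the branching vertices; there sin r = 1 and sin 2r = 0, so the two regimes fit
   together. The constant whose square is dropped is the Wronskian of phi and cos (k d). The limit K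
   to 2 k is needed because positivity may fail at 2 k itself, as it does on an interval. *)
Require Import Defs.
From HB Require Import structures.
From mathcomp Require Import all_boot all_order all_algebra.
From mathcomp Require Import all_classical all_reals all_analysis.
From mathcomp Require Import measurable_realfun.
From mathcomp Require Import ring lra zify.
Set Implicit Arguments.
Unset Strict Implicit.
Unset Printing Implicit Defensive.
Import Order.TTheory GRing.Theory Num.Theory numFieldNormedType.Exports.
Local Open Scope classical_set_scope.
Local Open Scope ring_scope.

(** * Calculus on an interval *)

Section Calculus.
Context {R : realType}.
Implicit Types (f g : R -> R) (x y k A B : R).

Lemma derD f g x a b : is_derive x 1 f a -> is_derive x 1 g b ->
  is_derive x 1 (fun y => f y + g y) (a + b).
Proof. exact: is_deriveD. Qed.

Lemma derB f g x a b : is_derive x 1 f a -> is_derive x 1 g b ->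
  is_derive x 1 (fun y => f y - g y) (a - b).
Proof. exact: is_deriveB. Qed.

Lemma derM f g x a b : is_derive x 1 f a -> is_derive x 1 g b ->
  is_derive x 1 (fun y => f y * g y) (f x * b + g x * a).
Proof. exact: is_deriveM. Qed.

Lemma derV g x b : g x != 0 -> is_derive x 1 g b ->
  is_derive x 1 (fun y => (g y)^-1) (- b / g x ^+ 2).
Proof.
move=> g0 dg; apply: is_derive_eq (is_deriveV g0 dg) _.
by rewrite -[_ *: _]/(_ * _) mulrC mulrN mulNr.
Qed.

Lemma der_cst a x : is_derive x 1 (fun=> a) (0 : R).
Proof. exact: is_derive_cst. Qed.

Lemma der_id x : is_derive x 1 (fun y => y) (1 : R).
Proof. exact: is_derive_id. Qed.

Lemma derMc k x : is_derive x 1 (fun y => k * y) k.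
Proof. by apply: is_derive_eq (derM (der_cst k x) (der_id x)) _; ring. Qed.

Lemma der_cos f x a : is_derive x 1 f a ->
  is_derive x 1 (fun y => cos (f y)) (- sin (f x) * a).
Proof. by move=> df; exact: is_derive1_comp. Qed.

Lemma der_sin f x a : is_derive x 1 f a ->
  is_derive x 1 (fun y => sin (f y)) (cos (f x) * a).
Proof. by move=> df; exact: is_derive1_comp. Qed.

Lemma der_continuous f x a : is_derive x 1 f a -> {for x, continuous f}.
Proof.
by move=> df; apply/differentiable_continuous/derivable1_diffP; exact: ex_derive.
Qed.

(* A premise ending in [is_derive] would trigger instance search. *)
Definition derivative_on a b f f' :=
  forall x, x \in `[a, b] -> is_derive x 1 f (f' x).

Lemma der_within f f' a b : derivative_on a b f f' ->
  {within `[a, b], continuous f}.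
Proof.
move=> df; apply: continuous_in_subspaceT => x /set_mem xab.
exact: der_continuous (df x xab).
Qed.

Lemma der_ge0_le f f' a b : a <= b ->
  derivative_on a b f f' ->
  (forall x, x \in `]a, b[ -> 0 <= f' x) -> f a <= f b.
Proof.
move=> ab df f'0; have oc x : x \in `]a, b[ -> x \in `[a, b].
  by apply: subset_itvW; rewrite bnd_simp.
apply: (@ger0_derive1_ndecr _ f a b) => //.
- by move=> x /oc /df ?; exact: ex_derive.
- move=> x xab; rewrite derive1E (@derive_val _ _ _ _ _ _ _ (df x (oc x xab))).
  exact: f'0.
- exact: der_within df.
Qed.

Lemma der0_eq f f' a b : a <= b ->
  derivative_on a b f f' ->
  (forall x, x \in `]a, b[ -> f' x = 0) -> f a = f b.
Proof.
move=> ab df f'0; apply/eqP; rewrite eq_le (@der_ge0_le f f')//=; last first.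
  by move=> x /f'0 ->.
rewrite -lerN2 -[- f a]sub0r -[- f b]sub0r.
apply: (@der_ge0_le (fun x => 0 - f x) (fun x => 0 - f' x)) => //.
- by move=> x xab; exact: derB (der_cst _ _) (df _ xab).
- by move=> x /f'0 ->; rewrite subrr.
Qed.

(** Monotonicity squeezes [f] to a constant, and a derivative depends only on the germ. In the
    equality discussion this turns a vanishing total into pointwise vanishing without any
    integral. *)
Lemma der_ge0_eq0 f f' a b :
  derivative_on a b f f' ->
  (forall x, x \in `]a, b[ -> 0 <= f' x) -> f b <= f a ->
  forall x, x \in `]a, b[ -> f' x = 0.
Proof.
move=> df f'0 fba x xab; have := xab; rewrite in_itv/= => /andP[ax xb].
have le y z : a <= y -> y <= z -> z <= b -> f y <= f z.
  move=> ay yz zb; apply: (@der_ge0_le f f' y z yz) => t;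
      rewrite in_itv/= => /andP[yt tz].
    by apply: df; rewrite in_itv/= (le_trans ay yt) (le_trans tz zb).
  by apply: f'0; rewrite in_itv/= (le_lt_trans ay yt) (lt_le_trans tz zb).
have fE y : a <= y -> y <= b -> f y = f a.
  move=> ay yb; apply/eqP; rewrite eq_le (le a y)// andbT.
  by apply: le_trans fba; exact: le.
have xab' : x \in `[a, b] by rewrite in_itv/= !ltW.
rewrite -(@derive_val _ _ _ _ _ _ _ (df x xab')) -(@derive_cst _ _ _ (f a) x 1).
apply: near_eq_derive.
have : \forall y \near x, y \in `]a, b[ by exact: near_in_itvoo.
by apply: filterS => y; rewrite in_itv/= => /andP[ay yb]; rewrite fE// ltW.
Qed.

(* The general solution of [u'' = - k ^+ 2 * u]; its derivative is
   [k * trig k B (- A)]. *)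
Definition trig k A B x := A * cos (k * x) + B * sin (k * x).

Lemma der_trig k A B x : is_derive x 1 (trig k A B) (k * trig k B (- A) x).
Proof.
apply: is_derive_eq (derD (derM (der_cst _ _) (der_cos (derMc k x)))
                          (derM (der_cst _ _) (der_sin (derMc k x)))) _.
by rewrite /trig; ring.
Qed.

Lemma trigNN k A B x : trig k (- A) (- B) x = - trig k A B x.
Proof. by rewrite /trig; ring. Qed.

Lemma trig0 k A B : trig k A B 0 = A.
Proof. by rewrite /trig mulr0 cos0 sin0; ring. Qed.

Lemma sin2E x : sin (2 * x) = 2 * (sin x * cos x).
Proof. by rewrite mulr_natl sin_mulr2n mulr2n; ring. Qed.

Lemma trig_sqr k A B x : trig k A B x ^+ 2 + trig k B (- A) x ^+ 2 = A ^+ 2 + B ^+ 2.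
Proof. by rewrite -[RHS]mul1r -(cos2Dsin2 (k * x)) /trig; ring. Qed.

Lemma trig_eq0 k A B x : trig k A B x = 0 -> trig k B (- A) x = 0 -> A = 0 /\ B = 0.
Proof.
move=> e1 e2; have := trig_sqr k A B x.
rewrite e1 e2 expr0n addr0 => /esym/eqP; rewrite paddr_eq0 ?sqr_ge0// !sqrf_eq0.
by move=> /andP[/eqP-> /eqP->].
Qed.

(* Evaluation from the other endpoint of an edge of length [l]. *)
Lemma trig_rev k A B l x :
  trig k (trig k A B l) (- trig k B (- A) l) x = trig k A B (l - x).
Proof. by rewrite /trig mulrBr cosB sinB; ring. Qed.

Lemma trig_revD k A B l x :
  trig k (- trig k B (- A) l) (- trig k A B l) x = - trig k B (- A) (l - x).
Proof. by rewrite /trig mulrBr cosB sinB; ring. Qed.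

Lemma trig_shift k al be d x :
  trig k (trig k al be d) (trig k be (- al) d) x = trig k al be (d + x).
Proof. by rewrite /trig [k * (d + x)]mulrDr cosD sinD; ring. Qed.

Lemma trig_shiftD k al be d x :
  trig k (trig k be (- al) d) (- trig k al be d) x = trig k be (- al) (d + x).
Proof. by rewrite /trig [k * (d + x)]mulrDr cosD sinD; ring. Qed.

(** The bound x cot x <= 1 without division: sin y - y cos y vanishes at 0 and has derivative y sin
    y. *)
Lemma xcos_le_sin x : 0 <= x <= pi -> x * cos x <= sin x.
Proof.
move=> /andP[x0 xpi]; rewrite -subr_ge0.
have -> : 0 = sin 0 - 0 * cos 0 :> R by rewrite sin0 mul0r subr0.
apply: (@der_ge0_le (fun y => sin y - y * cos y) (fun y => y * sin y)) => //.
  move=> y _; apply: is_derive_eq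
    (derB (der_sin (der_id y)) (derM (der_id y) (der_cos (der_id y)))) _.
  by ring.
move=> y; rewrite in_itv/= => /andP[y0 yx].
by rewrite mulr_ge0 ?(ltW y0)// sin_ge0_pi// !ltW// (lt_le_trans yx).
Qed.

Lemma harmonic_trig k f f1 a b : 0 < k -> a <= b ->
  derivative_on a b f f1 ->
  derivative_on a b f1 (fun x => - k ^+ 2 * f x) ->
  exists A B, forall x, x \in `[a, b] ->
    f x = trig k A B x /\ f1 x = k * trig k B (- A) x.
Proof.
move=> k0 ab df df1.
(* Rotating the pair [(f, f1 / k)] back by the angle [k * x] gives the coefficients at [x]; the
   equation says that they do not change. *)
pose X x := f x * cos (k * x) - k^-1 * f1 x * sin (k * x).
pose Y x := f x * sin (k * x) + k^-1 * f1 x * cos (k * x).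
have kn0 : k != 0 by rewrite gt_eqF.
have dX : derivative_on a b X (fun=> 0).
  move=> x xab; apply: is_derive_eq (derB (derM (df _ xab) (der_cos (derMc k x)))
      (derM (derM (der_cst k^-1 x) (df1 _ xab)) (der_sin (derMc k x)))) _.
  by rewrite /=; field.
have dY : derivative_on a b Y (fun=> 0).
  move=> x xab; apply: is_derive_eq (derD (derM (df _ xab) (der_sin (derMc k x)))
      (derM (derM (der_cst k^-1 x) (df1 _ xab)) (der_cos (derMc k x)))) _.
  by rewrite /=; field.
have sub x y : x \in `[a, b] -> y \in `[a, x] -> y \in `[a, b].
  rewrite !in_itv/= => /andP[_ xb] /andP[-> yx] /=; exact: le_trans yx xb.
exists (X a), (Y a) => x xab.
have ax : a <= x by move: xab; rewrite in_itv/= => /andP[].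
have -> : X a = X x.
  exact: (@der0_eq X (fun=> 0) a x ax (fun y yx => dX y (sub _ _ xab yx)) (fun _ _ => erefl)).
have -> : Y a = Y x.
  exact: (@der0_eq Y (fun=> 0) a x ax (fun y yx => dY y (sub _ _ xab yx)) (fun _ _ => erefl)).
split; first by rewrite /X /Y /trig -[LHS]mul1r -(cos2Dsin2 (k * x)); ring.
rewrite /X /Y /trig -[LHS]mul1r -(cos2Dsin2 (k * x)); field; exact: kn0.
Qed.

End Calculus.

(** * Integrals and primitives *)

Section Integral.
Context {R : realType}.
Notation mu := (@lebesgue_measure R).
Implicit Types (f g h : R -> R) (a b c l x : R).

Definition itvint a b f : R := \int[mu]_(x in `[a, b]) f x.

Definition itv_integrable a b f := mu.-integrable `[a, b] (EFin \o f).

Definition itv_square_integrable l f := (f \_ `[0, l]) \in Lfun mu 2%:E.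

Lemma itv_integrableS a b c d f : c <= a -> b <= d ->
  itv_integrable c d f -> itv_integrable a b f.
Proof.
move=> ca bd; apply: integrableS; [exact: measurable_itv|exact: measurable_itv|].
by apply: subset_itvScc; rewrite bnd_simp.
Qed.

Lemma itvint_xx a f : itvint a a f = 0.
Proof. by rewrite /itvint set_itv1 Rintegral_set1. Qed.

Lemma eq_itvint a b f g : {in `[a, b], f =1 g} -> itvint a b f = itvint a b g.
Proof. by move=> fg; apply: eq_Rintegral => x /set_mem; exact: fg. Qed.

Lemma itvint_cat c a b f : a <= c -> c <= b -> itv_integrable a b f ->
  itvint a b f = itvint a c f + itvint c b f.
Proof.
move=> ac cb fi; rewrite addrC; apply/eqP; rewrite -subr_eq; apply/eqP.
rewrite /itvint Rintegral_itvB ?bnd_simp//.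
rewrite Rintegral_itv_obnd_cbnd//.
apply: integrableS fi; [exact: measurable_itv|exact: measurable_itv|].
by apply: subset_itvScc; rewrite bnd_simp.
Qed.

Lemma continuous_itv_integrable a b f :
  {within `[a, b], continuous f} -> itv_integrable a b f.
Proof. by move=> cf; apply: continuous_compact_integrable => //; exact: segment_compact. Qed.

Lemma continuous_itv_bounded a b f : {within `[a, b], continuous f} ->
  exists2 C, 0 <= C & forall x, x \in `[a, b] -> `|f x| <= C.
Proof.
move=> cf; have := @continuous_compact _ _ f `[a, b] cf (@segment_compact _ a b).
move=> /compact_bounded[M [_ mrt]]; exists (`|M| + 1); first by rewrite addr_ge0.
move=> x xab; apply: (mrt (`|M| + 1)); last by exists x.
by rewrite ltr_pwDr// ler_norm.
Qed.

Lemma itvintD a b f g : itv_integrable a b f -> itv_integrable a b g ->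
  itvint a b (fun x => f x + g x) = itvint a b f + itvint a b g.
Proof. by move=> fi gi; apply: RintegralD. Qed.

Lemma itvintB a b f g : itv_integrable a b f -> itv_integrable a b g ->
  itvint a b (fun x => f x - g x) = itvint a b f - itvint a b g.
Proof. by move=> fi gi; apply: RintegralB. Qed.

Lemma itvintZ a b c f : itv_integrable a b f ->
  itvint a b (fun x => c * f x) = c * itvint a b f.
Proof. by move=> fi; apply: RintegralZl. Qed.

Lemma itvint_cst a b c : a <= b -> itvint a b (fun=> c) = c * (b - a).
Proof.
move=> ab; rewrite /itvint Rintegral_cst//; congr (_ * _).
have := @lebesgue_measure_itv R `[a, b]; rewrite /= lte_fin => ->.
by move: ab; case: ltgtP => // -> _; rewrite subrr.
Qed.

Lemma le_itvint a b f g : itv_integrable a b f -> itv_integrable a b g ->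
  (forall x, x \in `[a, b] -> f x <= g x) -> itvint a b f <= itvint a b g.
Proof. by move=> fi gi fg; apply: le_Rintegral. Qed.

Lemma itv_integrable_norm a b f :
  itv_integrable a b f -> itv_integrable a b (fun x => `|f x|).
Proof. by move=> fi; exact: integrable_norm. Qed.

Lemma le_norm_itvint a b f : itv_integrable a b f ->
  `|itvint a b f| <= itvint a b (fun x => `|f x|).
Proof. by move=> fi; apply: le_normr_Rintegral. Qed.

Lemma itv_integrableD a b f g : itv_integrable a b f -> itv_integrable a b g ->
  itv_integrable a b (fun x => f x + g x).
Proof. by move=> fi gi; have := integrableD _ fi gi; apply. Qed.

Lemma itv_integrableB a b f g : itv_integrable a b f -> itv_integrable a b g ->
  itv_integrable a b (fun x => f x - g x).
Proof. by move=> fi gi; have := integrableB _ fi gi; apply. Qed.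

Lemma itv_integrableZ a b c f : itv_integrable a b f ->
  itv_integrable a b (fun x => c * f x).
Proof. by move=> fi; have := integrableZl _ c fi; apply. Qed.

Lemma itv_integrable_cst a b c : itv_integrable a b (fun=> c).
Proof. by apply: continuous_itv_integrable => x; exact: cvg_cst. Qed.

Lemma le_norm_itvint_bound a b f g C : a <= b -> 0 <= C -> itv_integrable a b f ->
  itv_integrable a b g ->
  (forall x, x \in `[a, b] -> `|f x| <= C * `|g x|) ->
  `|itvint a b f| <= C * itvint a b (fun x => `|g x|).
Proof.
move=> ab C0 fi gi fg; apply: le_trans (le_norm_itvint fi) _.
rewrite -itvintZ; last exact: itv_integrable_norm.
apply: le_itvint => //; first exact: itv_integrable_norm.
by apply: itv_integrableZ; exact: itv_integrable_norm.
Qed.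

Lemma itvint_FTC2 a b (F f : R -> R) : a <= b ->
  derivative_on a b F f ->
  {within `[a, b], continuous f} -> itvint a b f = F b - F a.
Proof.
rewrite le_eqVlt => /predU1P[-> _ _|ab dF cf]; first by rewrite itvint_xx subrr.
have oc x : x \in `]a, b[ -> x \in `[a, b].
  by apply: subset_itvW; rewrite bnd_simp.
have [ac bc] : a \in `[a, b] /\ b \in `[a, b].
  by rewrite !in_itv/= !lexx (ltW ab).
rewrite /itvint /Rintegral (@continuous_FTC2 _ f F)//.
- split.
  + by move=> x /oc/dF ?; exact: ex_derive.
  + exact/cvg_at_right_filter/(der_continuous (dF _ ac)).
  + exact/cvg_at_left_filter/(der_continuous (dF _ bc)).
- by move=> x /oc/dF dFx; rewrite derive1E; exact: derive_val.
Qed.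

Lemma clamp_lipschitz a b x y :
  `|Num.max a (Num.min x b) - Num.max a (Num.min y b)| <= `|x - y|.
Proof.
rewrite /Num.max /Num.min ler_norml; case: (ger0P (x - y)) => ?;
  case: (ltP x b) => ?; case: (ltP y b) => ?; do ?case: ltP => ?; lra.
Qed.

Lemma continuous_antiderivative a b f : a <= b -> {within `[a, b], continuous f} ->
  exists F, derivative_on a b F f.
Proof.
move=> ab cf.
(* A retraction of the line onto [a, b]: [f \o p] is continuous everywhere, although [f] is so only
   within the interval. *)
pose p x := Num.max a (Num.min x b).
have cp : continuous p.
  move=> x; apply/cvgrPdist_lt => e e0; near=> y.
  apply: (@le_lt_trans _ _ `|x - y|); last first.
    by near: y; exact: (@cvgr_dist_lt _ _ _ (nbhs x)).
  exact: clamp_lipschitz.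
have pab x : p x \in `[a, b].
  by rewrite in_itv/= /p le_max lexx/= ge_max ab ge_min lexx orbT.
have pE x : x \in `[a, b] -> p x = x.
  by rewrite in_itv/= /p => /andP[ax xb]; rewrite min_l// max_r.
have cfp : continuous (f \o p).
  move=> x; apply: (@cvg_comp _ _ _ p f _ (within `[a, b] (nbhs (p x)))).
    move=> U /= /cp Ux; change (nbhs x (p @^-1` U)).
    by apply: (@filterS _ (nbhs x) _ (p @^-1` _) _ _ Ux) => y; apply; exact: pab.
  have /subspace_continuousP cf' := cf; exact: cf' (p x) (pab x).
(* Integrating from [a - 1], and up to [b + 1] below, makes [a] and [b] interior points, so that the
   derivative there is two-sided. *)
pose F x := itvint (a - 1) x (f \o p).
exists F => x xab; have := xab; rewrite in_itv/= => /andP[ax xb].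
have xb1 : x < b + 1 by rewrite (le_lt_trans xb)// ltrDl.
have [|||dF F'] := @continuous_FTC1_closed _ (f \o p) (a - 1) x (b + 1) xb1.
- by apply: continuous_itv_integrable; exact: continuous_subspaceT.
- by rewrite (lt_le_trans _ ax)// gtrDl ltrN10.
- exact: cfp.
apply: DeriveDef; first exact: dF.
by rewrite -derive1E -[RHS](congr1 f (pE _ xab)); exact: F'.
Unshelve. all: by end_near. Qed.

Lemma bounded_square_integrable l f C : measurable_fun `[0, l] f ->
  (forall x, x \in `[0, l] -> `|f x| <= C) -> itv_square_integrable l f.
Proof.
move=> mf fC.
have fi : itv_integrable 0 l (fun x => `|f x| `^ 2).
  apply: measurable_bounded_integrable => //.
  - have := @lebesgue_measure_itv R `[0, l]; rewrite /= => ->.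
    by case: ifPn => // _; rewrite -EFinB ltry.
  - apply: (measurableT_comp (measurable_powR _)) => //; exact: measurableT_comp.
  - exists (C `^ 2); split; first exact: num_real.
    move=> M CM x xl /=; apply: le_trans (ltW CM).
    rewrite ger0_norm ?powR_ge0// ge0_ler_powR ?nnegrE// ?fC//.
    by rewrite (le_trans _ (fC _ xl)).
rewrite /itv_square_integrable inE; apply/andP; split; rewrite inE/=.
  by apply/(measurable_restrictT _ _).1.
rewrite /finite_norm unlock poweR_lty//.
move: fi => /integrableP[_]; apply: le_lt_trans.
rewrite [leRHS]integral_mkcond le_eqVlt; apply/orP; left; apply/eqP.
apply: eq_integral => x _.
case: (boolP (x \in `[0, l]%classic)) => xl; rewrite /= /patch ?xl ?(negbTE xl) /=.
  by rewrite [in RHS]ger0_norm ?powR_ge0.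
by rewrite normr0 powR0.
Qed.

Lemma continuous_square_integrable l f :
  {within `[0, l], continuous f} -> itv_square_integrable l f.
Proof.
move=> cf; have [C _ fC] := continuous_itv_bounded cf.
apply: bounded_square_integrable fC.
by apply: subspace_continuous_measurable_fun.
Qed.

Lemma square_integrableM l f g : itv_square_integrable l f ->
  itv_square_integrable l g -> itv_integrable 0 l (fun x => f x * g x).
Proof.
move=> lf lg; have /Lfun1_integrable fg := Lfun2_mul_Lfun1 lf lg.
rewrite /itv_integrable -[X in mu.-integrable X _]setTI.
apply/integrable_restrict => //; move: fg; apply: eq_integrable => // x _ /=.
by rewrite /patch; case: ifPn => _ //=; rewrite mulr0.
Qed.

Lemma square_integrable_integrable l f :
  itv_square_integrable l f -> itv_integrable 0 l f.
Proof.
move=> lf; have c1 : itv_square_integrable l (fun=> 1).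
  by apply: continuous_square_integrable => x; exact: cvg_cst.
have := square_integrableM lf c1; apply: eq_integrable => // x _ /=.
by rewrite mulr1.
Qed.

Lemma continuous_itvint b f : 0 <= b -> itv_integrable 0 b f ->
  {within `[0, b], continuous (fun x => itvint 0 x f)}.
Proof. by move=> b0 fi; exact: parameterized_integral_continuous. Qed.

Lemma within_continuousM a b f g : {within `[a, b], continuous f} ->
  {within `[a, b], continuous g} -> {within `[a, b], continuous (fun x => f x * g x)}.
Proof. by move=> cf cg x; apply: cvgM; [exact: cf|exact: cg]. Qed.

Definition primitive_of l g g1 :=
  forall x, x \in `[0, l] -> g x = g 0 + itvint 0 x g1.

Lemma primitive_continuous l g g1 : 0 <= l -> itv_integrable 0 l g1 ->
  primitive_of l g g1 -> {within `[0, l], continuous g}.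
Proof.
move=> l0 gi gE.
have -> : {within `[0, l], continuous g} =
    {within `[0, l], continuous (fun x => g 0 + itvint 0 x g1)}.
  by apply/propext; split; apply: subspace_eq_continuous => x /set_mem /gE.
move=> x; apply: cvgD; first exact: cvg_cst.
exact: continuous_itvint.
Qed.

Lemma primitive_incr l g g1 s t : itv_integrable 0 l g1 -> primitive_of l g g1 ->
  0 <= s -> s <= t -> t <= l -> g t - g s = itvint s t g1.
Proof.
move=> gi gE s0 st tl.
rewrite gE ?in_itv/= ?(le_trans s0)// [g s]gE ?in_itv/= ?s0 ?(le_trans st)//.
rewrite (@itvint_cat s 0 t) //; first by ring.
exact: itv_integrableS gi.
Qed.

Lemma primitive_FTC l (F F1 : R -> R) : derivative_on 0 l F F1 ->
  {within `[0, l], continuous F1} -> primitive_of l F F1.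
Proof.
move=> dF cF1 x; rewrite in_itv/= => /andP[x0 xl].
suff -> : itvint 0 x F1 = F x - F 0 by ring.
apply: itvint_FTC2 => //.
  move=> y; rewrite in_itv/= => /andP[y0 yx]; apply: dF.
  by rewrite in_itv/= y0 (le_trans yx).
apply: continuous_subspaceW cF1; apply: subset_itvScc; rewrite bnd_simp//.
Qed.

(* The defect of the formula on [s, t] is at most
   [2 * C * (t - s)] times the integral of [`|g1|], and it is additive:
   cutting [0, l] into [n] equal pieces shows that it is [O(1/n)]. *)
Lemma integration_by_parts_primitive l (F F1 g g1 : R -> R) : 0 <= l ->
  {within `[0, l], continuous F1} -> primitive_of l F F1 ->
  itv_square_integrable l g1 -> primitive_of l g g1 ->
  itvint 0 l (fun x => F x * g1 x) + itvint 0 l (fun x => F1 x * g x)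
  = F l * g l - F 0 * g 0.
Proof.
move=> l0 cF1 FE g2 gE.
have gi := square_integrable_integrable g2.
have F1i := continuous_itv_integrable cF1.
have cF := primitive_continuous l0 F1i FE.
have cg := primitive_continuous l0 gi gE.
have Fg1i : itv_integrable 0 l (fun x => F x * g1 x).
  exact: square_integrableM (continuous_square_integrable cF) g2.
have F1gi : itv_integrable 0 l (fun x => F1 x * g x).
  exact: continuous_itv_integrable (within_continuousM cF1 cg).
have [C C0 F1C] := continuous_itv_bounded cF1.
pose V s t := itvint s t (fun x => `|g1 x|).
pose E s t := F t * g t - F s * g s -
  (itvint s t (fun x => F x * g1 x) + itvint s t (fun x => F1 x * g x)).
have piece (s t : R) : 0 <= s -> s <= t -> t <= l -> `|E s t| <= 2 * C * (t - s) * V s t.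
  move=> s0 st tl.
  have sub (h : R -> R) : itv_integrable 0 l h -> itv_integrable s t h.
    exact: itv_integrableS.
  have Vi := itv_integrable_norm (sub _ gi).
  (* [g] need not be differentiable anywhere in particular, so the product rule is replaced by F(t)
     g(t) - F(s) g(s) = F(t) (g(t) - g(s)) + g(s) (F(t) - F(s)). *)
  have e1 : itvint s t (fun x => (F t - F x) * g1 x) =
      F t * (g t - g s) - itvint s t (fun x => F x * g1 x).
    rewrite (primitive_incr gi gE)// -itvintZ ?sub// -itvintB; last 2 first.
    - by apply: itv_integrableZ; exact: sub.
    - exact: sub.
    by apply: eq_itvint => x _; rewrite mulrBl.
  have e2 : itvint s t (fun x => F1 x * (g s - g x)) =
      g s * (F t - F s) - itvint s t (fun x => F1 x * g x).
    rewrite (primitive_incr F1i FE)// -itvintZ ?sub// -itvintB; last 2 first.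
    - by apply: itv_integrableZ; exact: sub.
    - exact: sub.
    by apply: eq_itvint => x _; ring.
  have -> : E s t = itvint s t (fun x => (F t - F x) * g1 x) +
      itvint s t (fun x => F1 x * (g s - g x)).
    by rewrite e1 e2 /E; ring.
  have -> : 2 * C * (t - s) * V s t = C * (t - s) * V s t + C * V s t * (t - s).
    by ring.
  have in0l (x : R) : x \in `[s, t] -> x \in `[0, l].
    rewrite !in_itv/= => /andP[sx xt].
    by rewrite (le_trans s0 sx) (le_trans xt tl).
  have V0 : 0 <= V s t by apply: Rintegral_ge0.
  apply: le_trans (ler_normD _ _) _; apply: lerD.
    apply: le_norm_itvint_bound => //.
    - by rewrite mulr_ge0// subr_ge0.
    - apply: eq_integrable (itv_integrableB (itv_integrableZ (F t) (sub _ gi)) (sub _ Fg1i)) => //.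
      by move=> x _ /=; congr EFin; ring.
    - exact: sub.
    - move=> x xst; have := xst; rewrite in_itv/= => /andP[sx xt].
      rewrite normrM ler_wpM2r// (primitive_incr F1i FE)// ?(le_trans s0)//.
      apply: (@le_trans _ _ (C * (t - x))); last first.
        by apply: ler_wpM2l => //; rewrite lerD2l lerN2.
      rewrite -itvint_cst//; apply: le_trans (le_norm_itvint _) _.
        by apply: itv_integrableS F1i => //; exact: le_trans sx.
      apply: le_itvint; [|exact: itv_integrable_cst|].
        apply: itv_integrable_norm.
        by apply: itv_integrableS F1i => //; exact: le_trans sx.
      move=> y; rewrite in_itv/= => /andP[xy yt]; apply: F1C.
      by apply: in0l; rewrite in_itv/= (le_trans sx xy).
  rewrite -[X in _ <= X]mulr1 -mulrA -[(t - s) * 1]mulrC -(itvint_cst 1 st).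
  have -> : itvint s t (fun=> 1) = itvint s t (fun=> `|1|) :> R.
    by apply: eq_itvint => x _; rewrite normr1.
  apply: le_norm_itvint_bound => //.
  - by rewrite mulr_ge0.
  - apply: eq_integrable (itv_integrableB (itv_integrableZ (g s) (sub _ F1i)) (sub _ F1gi)) => //.
    by move=> x _ /=; congr EFin; ring.
  - exact: itv_integrable_cst.
  - move=> x xst; have := xst; rewrite in_itv/= => /andP[sx xt].
    rewrite normr1 mulr1 normrM ler_pM// ?F1C ?in0l//.
    rewrite distrC (primitive_incr gi gE)// ?(le_trans xt)//.
    apply: le_trans (le_norm_itvint _) _.
      by apply: itv_integrableS gi => //; exact: le_trans xt tl.
    rewrite /V (@itvint_cat x s t)// lerDl; exact: Rintegral_ge0.
have Ecat (s t : R) : 0 <= s -> s <= t -> t <= l -> E 0 t = E 0 s + E s t.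
  move=> s0 st tl; rewrite /E.
  rewrite (@itvint_cat s 0 t (fun x => F x * g1 x))//; last exact: itv_integrableS Fg1i.
  rewrite (@itvint_cat s 0 t (fun x => F1 x * g x))//; last exact: itv_integrableS F1gi.
  by ring.
have sum (n : nat) (h : R) : 0 <= h -> n%:R * h <= l -> `|E 0 (n%:R * h)| <= 2 * C * h * V 0 (n%:R * h).
  move=> h0; elim: n => [|n IH].
    by rewrite mul0r /E /V !itvint_xx addr0 !subrr normr0 mulr0.
  rewrite -natr1 mulrDl mul1r => nhl.
  have nh0 : 0 <= n%:R * h by rewrite mulr_ge0.
  have nhh : n%:R * h <= n%:R * h + h by rewrite lerDl.
  have gi' : itv_integrable 0 (n%:R * h + h) (fun x => `|g1 x|).
    by apply: itv_integrable_norm; exact: itv_integrableS gi.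
  rewrite (Ecat (n%:R * h))// /V (@itvint_cat (n%:R * h) 0 (n%:R * h + h))//.
  rewrite mulrDr; apply: le_trans (ler_normD _ _) (lerD _ _).
    by apply: IH; exact: le_trans nhl.
  apply: le_trans (piece _ _ nh0 nhh nhl) _.
  by rewrite addrAC subrr add0r.
suff E0 : E 0 l = 0.
  by move/eqP: E0; rewrite subr_eq0 => /eqP ->.
apply/eqP; rewrite -normr_le0; apply/ler_addgt0Pr => e e0; rewrite add0r.
pose n := (Num.bound (2 * C * l * V 0 l / e)).+1.
have n0 : 0 < n%:R :> R by rewrite ltr0n.
have V0 : 0 <= V 0 l by apply: Rintegral_ge0.
have := sum n (l / n%:R); rewrite mulrCA divff ?gt_eqF// mulr1.
move=> /(_ (divr_ge0 l0 (ltW n0)) (lexx _)) /le_trans; apply.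
have -> : 2 * C * (l / n%:R) * V 0 l = 2 * C * l * V 0 l / n%:R by ring.
rewrite ler_pdivrMr// [e * _]mulrC.
have : 2 * C * l * V 0 l / e < n%:R.
  apply: lt_trans (_ : (Num.bound (2 * C * l * V 0 l / e))%:R < _).
    by rewrite archi_boundP// !mulr_ge0// invr_ge0 ltW.
  by rewrite ltr_nat.
by rewrite ltr_pdivrMr// => /ltW.
Qed.

End Integral.

(** * Eigenvalues as solvability of a trigonometric system *)

Section Flux.
Context {R : realType} {V E : finType}.
Implicit Types (s t : E -> V) (a b : E -> R) (w : V).

(** With [a] and [b] the derivatives at the start and at the end of each edge, this is the sum of
    the derivatives leaving [w]. A loop contributes with both of its ends. *)
Definition flux s t a b w : R :=
  \sum_e ((s e == w)%:R * a e - (t e == w)%:R * b e).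

Lemma sum_endpoint s a (h : V -> R) :
  \sum_e h (s e) * a e = \sum_w h w * \sum_e (s e == w)%:R * a e.
Proof.
rewrite (eq_bigr (fun e => \sum_w h w * ((s e == w)%:R * a e))); last first.
  move=> e _; rewrite (bigD1 (s e))//= eqxx mul1r big1 ?addr0// => w.
  by rewrite eq_sym => /negbTE ->; rewrite mul0r mulr0.
by rewrite exchange_big/=; apply: eq_bigr => w _; rewrite mulr_sumr.
Qed.

(** Boundary terms collected edge by edge are regrouped by vertices, where either [h] or the flux
    vanishes. *)
Lemma sum_flux s t a b (h : V -> R) :
  \sum_e (h (s e) * a e - h (t e) * b e) = \sum_w h w * flux s t a b w.
Proof.
rewrite big_split/= sumrN !sum_endpoint -sumrB; apply: eq_bigr => w _.
by rewrite /flux sumrB mulrBr.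
Qed.

(* The functions [trig k (A e) (B e)] on the edges, with vertex values [val],
   satisfy Dirichlet conditions on [D] and Kirchhoff conditions elsewhere. *)
Definition trig_system s t (l : E -> R) (D : {set V}) (k : R) (A B : E -> R) (val : V -> R) :=
  [/\ forall e, A e = val (s e),
      forall e, trig k (A e) (B e) (l e) = val (t e),
      forall w, w \in D -> val w = 0 &
      forall w, w \notin D -> flux s t B (fun e => trig k (B e) (- A e) (l e)) w = 0].

Definition nontrivial (A B : E -> R) := exists e, (A e != 0) || (B e != 0).

End Flux.

Section Complex.
Local Open Scope complex_scope.
Context {R : realType}.
Implicit Types (z : R[i]) (f : R -> R) (h : R -> R[i]).

Lemma within_continuous_complex a b f : {within `[a, b], continuous f} ->
  {within `[a, b], continuous (fun x => (f x)%:C : R[i]^o)}.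
Proof.
move=> cf x; apply/cvgrPdist_lt => /= e; rewrite ltcE/= => /andP[/eqP e0 er].
have /cvgrPdist_lt /(_ _ er) := cf x.
apply: filterS => y /= xy.
rewrite -rmorphB/= normc_def/= expr0n addr0 sqrtr_sqr ltcE/= e0 eqxx /=.
exact: xy.
Qed.

Lemma Re_mulJ z (r : R) : complex.Re (z * (r%:C)^*) = complex.Re z * r.
Proof. by case: z => x y /=; ring. Qed.

Lemma Im_mulJ z (r : R) : complex.Im (z * (r%:C)^*) = complex.Im z * r.
Proof. by case: z => x y /=; ring. Qed.

Lemma Re_mulCJ (r : R) z : complex.Re (r%:C * z^*) = r * complex.Re z.
Proof. by case: z => x y /=; ring. Qed.

Lemma Im_mulCJ (r : R) z : complex.Im (r%:C * z^*) = - (r * complex.Im z).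
Proof. by case: z => x y /=; ring. Qed.

Lemma Re_sum (I : finType) (F : I -> R[i]) :
  complex.Re (\sum_i F i) = \sum_i complex.Re (F i).
Proof.
by apply: (big_ind2 (fun z r => complex.Re z = r)) => // -[? ?] ? [? ?] ? <- <-.
Qed.

Lemma Im_sum (I : finType) (F : I -> R[i]) :
  complex.Im (\sum_i F i) = \sum_i complex.Im (F i).
Proof.
by apply: (big_ind2 (fun z r => complex.Im z = r)) => // -[? ?] ? [? ?] ? <- <-.
Qed.

Lemma H1_deriv_itv_Re l h h1 : H1_deriv_itv l h h1 ->
  itv_square_integrable l (fun x => complex.Re (h1 x)) /\
  primitive_of l (fun x => complex.Re (h x)) (fun x => complex.Re (h1 x)).
Proof.
move=> [[h2 _] hE]; split => // x /hE ->.
by case: (h 0) => ? ?.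
Qed.

Lemma H1_deriv_itv_Im l h h1 : H1_deriv_itv l h h1 ->
  itv_square_integrable l (fun x => complex.Im (h1 x)) /\
  primitive_of l (fun x => complex.Im (h x)) (fun x => complex.Im (h1 x)).
Proof.
move=> [[_ h2] hE]; split => // x /hE ->.
by case: (h 0) => ? ?.
Qed.

Lemma square_integrable0 (l : R) : itv_square_integrable l (fun=> 0).
Proof. by apply: continuous_square_integrable => x; exact: cvg_cst. Qed.

Lemma L2_itv_real l f : itv_square_integrable l f -> L2_itv l (fun x => (f x)%:C).
Proof. by move=> lf; split => //; exact: square_integrable0. Qed.

Lemma itvint0 (a b : R) : itvint a b (fun=> 0) = 0.
Proof. by rewrite /itvint /Rintegral integral0. Qed.

End Complex.

Section VertexValues.
Local Open Scope complex_scope.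
Context {R : realType} (G : metric_graph R).

Lemma endpoint_src (e : edge G) : endpoint e 0 (src e).
Proof. by left. Qed.

Lemma endpoint_tgt (e : edge G) : endpoint e (len e) (tgt e).
Proof. by right. Qed.

Lemma edge0 (e : edge G) : 0 \in `[0, len e].
Proof. by rewrite in_itv/= lexx ltW// len_gt0. Qed.

Lemma edge_len (e : edge G) : len e \in `[0, len e].
Proof. by rewrite in_itv/= lexx ltW// len_gt0. Qed.

Lemma endpoint_edge (e : edge G) (x : R) w : endpoint e x w -> x \in `[0, len e].
Proof. by case=> -[-> _]; [exact: edge0|exact: edge_len]. Qed.

Lemma vertex_values (g : graph_fun G) : graph_continuous g ->
  exists gval : vertex G -> R[i],
    (forall e x w, endpoint e x w -> g e x = gval w) /\
    (forall w, (forall e x, endpoint e x w -> g e x = 0) -> gval w = 0).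
Proof.
move=> [_ gg].
(* The default 0 concerns a vertex without edges, where the second claim has an empty premise and
   still demands the value 0. *)
pose gval w := if [pick e | src e == w] is Some e then g e 0 else
  if [pick e | tgt e == w] is Some e then g e (len e) else 0.
have gvalP w : gval w = 0 /\ (forall e x, ~ endpoint e x w) \/
    exists e x, endpoint e x w /\ gval w = g e x.
  rewrite /gval; case: pickP => [e /eqP <-|s0].
    by right; exists e, 0; split => //; exact: endpoint_src.
  case: pickP => [e /eqP <-|t0].
    by right; exists e, (len e); split => //; exact: endpoint_tgt.
  by left; split => // e x [] [_ /eqP]; [rewrite s0|rewrite t0].
exists gval; split => [e x w exw|w g0].
  have [[_ /(_ e x)//]|[e' [x' [exw' ->]]]] := gvalP w.
  apply: gg; [exact: endpoint_edge exw|exact: endpoint_edge exw'|].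
  by right; exists w.
by have [[]//|[e [x [exw ->]]]] := gvalP w; exact: g0 exw.
Qed.

Lemma vertex_values_continuous (g : graph_fun G) (gval : vertex G -> R[i]) :
  (forall e, {within `[0, len e], continuous (g e : R -> R[i]^o)}) ->
  (forall e, g e 0 = gval (src e) /\ g e (len e) = gval (tgt e)) ->
  graph_continuous g.
Proof.
move=> cg gE; split => // e e' x x' _ _.
have ge e1 x1 w : endpoint e1 x1 w -> g e1 x1 = gval w.
  by case=> -[-> <-]; case: (gE e1).
by move=> [[<- <-]//|[w [/ge -> /ge ->]]].
Qed.

End VertexValues.

(** * From trigonometric systems to eigenvalues *)

Section SystemToEigenvalue.
Local Open Scope complex_scope.
Context {R : realType}.
Implicit Types (k A B c l : R).

Lemma trigZ_within a b c k A B : {within `[a, b], continuous (fun x => c * trig k A B x)}.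
Proof.
apply: (@der_within _ _ (fun x => c * (k * trig k B (- A) x) + trig k A B x * 0)).
by move=> x _; exact: derM (der_cst c x) (der_trig k A B x).
Qed.

Lemma trig_within a b k A B : {within `[a, b], continuous (trig k A B)}.
Proof. by apply: der_within => x _; exact: der_trig. Qed.

Lemma trig_primitive l k A B :
  primitive_of l (trig k A B) (fun x => k * trig k B (- A) x).
Proof. by apply: primitive_FTC => [x _|]; [exact: der_trig|exact: trigZ_within]. Qed.

Lemma trig_itvint_by_parts l k A B (g g1 : R -> R) : 0 <= l ->
  itv_square_integrable l g1 -> primitive_of l g g1 ->
  itvint 0 l (fun x => k * trig k B (- A) x * g1 x) =
  itvint 0 l (fun x => k ^+ 2 * trig k A B x * g x) +
  k * (trig k B (- A) l * g l - B * g 0).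
Proof.
move=> l0 g2 gE; have gi := square_integrable_integrable g2.
pose F := fun x => k * trig k B (- A) x.
pose F1 := fun x => k * (k * trig k (- A) (- B) x) + trig k B (- A) x * 0.
have dF : derivative_on 0 l F F1.
  by move=> x _; exact: derM (der_cst k x) (der_trig k B (- A) x).
have F1E : F1 = (fun x => (- k ^+ 2) * trig k A B x).
  by apply/funext => x; rewrite /F1 trigNN; ring.
have cF1 : {within `[0, l], continuous F1} by rewrite F1E; exact: trigZ_within.
have := integration_by_parts_primitive l0 cF1 (primitive_FTC dF cF1) g2 gE.
rewrite /F trig0 => e.
rewrite [RHS]addrC mulrBr !mulrA -e.
rewrite -[LHS]addr0 -addrA; congr (_ + _); rewrite F1E.
rewrite -itvintD; last 2 first.
- apply: continuous_itv_integrable; apply: within_continuousM (primitive_continuous l0 gi gE).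
  exact: trigZ_within.
- apply: continuous_itv_integrable; apply: within_continuousM (primitive_continuous l0 gi gE).
  exact: trigZ_within.
by symmetry; rewrite -[RHS](itvint0 0 l); apply: eq_itvint => x _; ring.
Qed.

Variables (G : metric_graph R) (VD : {set vertex G}) (k : R) (A B : edge G -> R)
  (val : vertex G -> R).
Hypothesis sysP : trig_system src tgt len VD k A B val.

Lemma system_weak (g g1 : edge G -> R -> R) (gval : vertex G -> R) :
  (forall e, itv_square_integrable (len e) (g1 e)) ->
  (forall e, primitive_of (len e) (g e) (g1 e)) ->
  (forall e, g e 0 = gval (src e) /\ g e (len e) = gval (tgt e)) ->
  (forall w, w \in VD -> gval w = 0) ->
  \sum_e itvint 0 (len e) (fun x => k * trig k (B e) (- A e) x * g1 e x) =
  \sum_e itvint 0 (len e) (fun x => k ^+ 2 * trig k (A e) (B e) x * g e x).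
Proof.
move=> g2 gE gv gD; have [_ _ _ kirch] := sysP.
rewrite (eq_bigr _ (fun e _ => trig_itvint_by_parts k (A e) (B e)
  (ltW (len_gt0 e)) (g2 e) (gE e))) big_split/= -[RHS]addr0; congr (_ + _).
rewrite -mulr_sumr.
rewrite (eq_bigr (fun e => - (gval (src e) * B e - gval (tgt e) * trig k (B e) (- A e) (len e)))).
  rewrite sumrN sum_flux big1 ?oppr0 ?mulr0// => w _.
  by have [/gD ->|/kirch ->] := boolP (w \in VD); rewrite ?mul0r ?mulr0.
by move=> e _; have [-> ->] := gv e; ring.
Qed.

Lemma system_eigenvalue : 0 < k -> nontrivial A B -> graph_eigenvalue VD (k ^+ 2).
Proof.
move=> k0 [e0 AB0]; have [sysA sysl sysD kirch] := sysP.
exists (fun e x => (trig k (A e) (B e) x)%:C); split.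
  exists e0; have [A0|A0] := eqVneq (A e0) 0; last first.
    exists 0; split; first exact: edge0.
    by rewrite trig0; apply: contra_neq A0 => -[].
  move: AB0; rewrite A0 eqxx /= => B0.
  (* The function is [B e0 * sin (k * x)] here; the minimum keeps [x] in the edge and [k * x] in (0,
     pi). *)
  pose x := Num.min (len e0) (pi / 2 / k).
  have x0 : 0 < x by rewrite lt_min len_gt0 !divr_gt0// pi_gt0.
  exists x; split; first by rewrite in_itv/= ltW//= ge_min lexx.
  have sx : 0 < sin (k * x).
    apply: sin_gt0_pi; rewrite mulr_gt0//=.
    apply: (@le_lt_trans _ _ (pi / 2)).
      by rewrite -ler_pdivlMl// [_^-1 * _]mulrC ge_min lexx orbT.
    by rewrite ltr_pdivrMr// ltr_pMr ?pi_gt0// ltr1n.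
  have : B e0 * sin (k * x) != 0 by rewrite mulf_neq0// gt_eqF.
  apply: contra_neq => -[].
  by rewrite /trig mul0r add0r.
have valE e x w : endpoint e x w -> trig k (A e) (B e) x = val w.
  by case=> -[-> <-]; rewrite ?trig0.
split; first by move=> w e x wD /valE ->; rewrite sysD.
split.
  move=> e; have -> : (fun x => (k ^+ 2)%:C * (trig k (A e) (B e) x)%:C) =
      (fun x => (k ^+ 2 * trig k (A e) (B e) x)%:C).
    by apply/funext => x; rewrite -rmorphM.
  by apply: L2_itv_real; apply: continuous_square_integrable; exact: trigZ_within.
exists (fun e x => (k * trig k (B e) (- A e) x)%:C); split; first split.
- apply: (@vertex_values_continuous _ _ _ (fun w => (val w)%:C)).
    by move=> e; apply: within_continuous_complex; exact: trig_within.
  by move=> e; rewrite trig0 sysl sysA.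
- move=> e; split.
    by apply: L2_itv_real; apply: continuous_square_integrable; exact: trigZ_within.
  move=> x xl; rewrite (trig_primitive k (A e) (B e) xl) /cintegral.
  have := itvint0 (R := R) 0 x; rewrite /itvint /= => ->.
  by rewrite rmorphD.
move=> g g1 [gc gH] gD.
have [gval [gv gv0]] := vertex_values gc.
have gvD w : w \in VD -> gval w = 0 by move=> wD; apply: gv0 => e x; exact: gD.
have gs e := gv _ _ _ (endpoint_src e); have gt e := gv _ _ _ (endpoint_tgt e).
have eR := @system_weak (fun e x => complex.Re (g e x)) (fun e x => complex.Re (g1 e x))
  (fun w => complex.Re (gval w)).
have eI := @system_weak (fun e x => complex.Im (g e x)) (fun e x => complex.Im (g1 e x))
  (fun w => complex.Im (gval w)).
apply/eqP; rewrite eq_complex; apply/andP; split; apply/eqP; rewrite /L2_inner.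
- rewrite !Re_sum; transitivity (\sum_e itvint 0 (len e) (fun x => k * trig k (B e) (- A e) x * complex.Re (g1 e x))).
    by apply: eq_bigr => e _ /=; apply: eq_itvint => x _; rewrite Re_mulCJ.
  rewrite eR.
  + apply: eq_bigr => e _ /=; apply: eq_itvint => x _.
    by rewrite -rmorphM Re_mulCJ.
  + by move=> e; have [] := H1_deriv_itv_Re (gH e).
  + by move=> e; have [] := H1_deriv_itv_Re (gH e).
  + by move=> e; rewrite gs gt.
  + by move=> w /gvD ->.
- rewrite !Im_sum; transitivity (- \sum_e itvint 0 (len e) (fun x => k * trig k (B e) (- A e) x * complex.Im (g1 e x))).
    rewrite -sumrN; apply: eq_bigr => e _ /=; rewrite -[RHS]mulN1r -itvintZ; last first.
      apply: square_integrableM; last by have [] := H1_deriv_itv_Im (gH e).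
      by apply: continuous_square_integrable; exact: trigZ_within.
    by apply: eq_itvint => x _; rewrite Im_mulCJ mulN1r.
  rewrite eI.
  + rewrite -sumrN; apply: eq_bigr => e _ /=; rewrite -[LHS]mulN1r -itvintZ; last first.
      apply: continuous_itv_integrable; apply: within_continuousM.
        exact: trigZ_within.
      have [g1i gE] := H1_deriv_itv_Im (gH e).
      apply: (@primitive_continuous _ _ _ (fun x => complex.Im (g1 e x))).
      * exact: ltW (len_gt0 e).
      * exact: square_integrable_integrable g1i.
      * exact: gE.
    by apply: eq_itvint => x _; rewrite -rmorphM Im_mulCJ mulN1r.
  + by move=> e; have [] := H1_deriv_itv_Im (gH e).
  + by move=> e; have [] := H1_deriv_itv_Im (gH e).
  + by move=> e; rewrite gs gt.
  + by move=> w /gvD ->.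
Qed.

End SystemToEigenvalue.

(** * From eigenvalues to trigonometric systems *)

Section WeakEigenfunction.
Local Open Scope complex_scope.
Context {R : realType} (G : metric_graph R) (VD : {set vertex G}) (mu : R).
Implicit Types (g : edge G -> R -> R).

(** The real form of the eigenvalue problem. As [mu] is real, the real and the imaginary part of an
    eigenfunction satisfy it separately; the vertex values encode continuity. *)
Definition weak_eigenfunction (u u1 : edge G -> R -> R) (uval : vertex G -> R) :=
  [/\ forall e, itv_square_integrable (len e) (u1 e),
      forall e, primitive_of (len e) (u e) (u1 e),
      forall e, u e 0 = uval (src e) /\ u e (len e) = uval (tgt e),
      forall w, w \in VD -> uval w = 0 &
      forall (g g1 : edge G -> R -> R) (gval : vertex G -> R),
        (forall e, itv_square_integrable (len e) (g1 e)) ->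
        (forall e, primitive_of (len e) (g e) (g1 e)) ->
        (forall e, g e 0 = gval (src e) /\ g e (len e) = gval (tgt e)) ->
        (forall w, w \in VD -> gval w = 0) ->
        \sum_e itvint 0 (len e) (fun x => u1 e x * g1 e x) =
        mu * \sum_e itvint 0 (len e) (fun x => u e x * g e x)].

Lemma eigenvalue_weak : graph_eigenvalue VD mu ->
  exists u u1 uval, weak_eigenfunction u u1 uval /\
    exists e (x : R), x \in `[0, len e] /\ u e x != 0.
Proof.
move=> [f [[e0 [x0 [x0l fx0]]] [fD [_ [f1 [[fc fH] fw]]]]]].
have [fval [fv fv0]] := vertex_values fc.
have fs e := fv _ _ _ (endpoint_src e); have ft e := fv _ _ _ (endpoint_tgt e).
have fvD w : w \in VD -> fval w = 0 by move=> wD; apply: fv0 => e x; exact: fD.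
have test (g g1 : edge G -> R -> R) (gval : vertex G -> R) :
    (forall e, itv_square_integrable (len e) (g1 e)) ->
    (forall e, primitive_of (len e) (g e) (g1 e)) ->
    (forall e, g e 0 = gval (src e) /\ g e (len e) = gval (tgt e)) ->
    (forall w, w \in VD -> gval w = 0) ->
    L2_inner f1 (fun e x => (g1 e x)%:C) =
    L2_inner (fun e x => mu%:C * f e x) (fun e x => (g e x)%:C).
  move=> g2 gE gv gD; apply: fw.
    split.
      apply: (@vertex_values_continuous _ _ _ (fun w => (gval w)%:C)).
        move=> e; apply: within_continuous_complex.
        apply: primitive_continuous (gE e); first exact: ltW (len_gt0 e).
        exact: square_integrable_integrable.
      by move=> e; have [-> ->] := gv e.
    move=> e; split; first exact: L2_itv_real.
    move=> x xl; rewrite (gE e x xl) /cintegral /=.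
    have := itvint0 (R := R) 0 x; rewrite /itvint /= => ->.
    by rewrite rmorphD.
  move=> w e x wD; have [gs gt] := gv e.
  by case=> -[-> ew]; rewrite ?gs ?gt ew gD.
(* One of the two parts is nonzero at the given point, and that part is kept. *)
have [fR|fR] := eqVneq (complex.Re (f e0 x0)) 0.
  exists (fun e x => complex.Im (f e x)), (fun e x => complex.Im (f1 e x)),
    (fun w => complex.Im (fval w)); split; last first.
    exists e0, x0; split => //; apply: contra_neq fx0.
    by move: fR; case: (f e0 x0) => a b /= -> ->.
  split => [e|e|e|w /fvD -> //|g g1 gval g2 gE gv gD].
  - by have [] := H1_deriv_itv_Im (fH e).
  - by have [] := H1_deriv_itv_Im (fH e).
  - by rewrite fs ft.
  have /(congr1 (@complex.Im R)) := test g g1 gval g2 gE gv gD.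
  rewrite /L2_inner !Im_sum mulr_sumr => e; transitivity (\sum_e0 complex.Im (cintegral `[0, len e0] (fun x => f1 e0 x * (g1 e0 x)%:C^*))).
    by apply: eq_bigr => e1 _ /=; apply: eq_itvint => x _; rewrite Im_mulJ.
  rewrite e; apply: eq_bigr => e1 _ /=; rewrite -itvintZ.
    apply: eq_itvint => x _; rewrite Im_mulJ mulrA; congr (_ * _).
    by case: (f e1 x) => a b /=; ring.
  have [f2 fE] := H1_deriv_itv_Im (fH e1).
  apply: continuous_itv_integrable; apply: within_continuousM.
    by apply: primitive_continuous fE; rewrite ?ltW ?len_gt0//; exact: square_integrable_integrable.
  by apply: primitive_continuous (gE e1); rewrite ?ltW ?len_gt0//; exact: square_integrable_integrable.
exists (fun e x => complex.Re (f e x)), (fun e x => complex.Re (f1 e x)),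
  (fun w => complex.Re (fval w)); split; last by exists e0, x0.
split => [e|e|e|w /fvD -> //|g g1 gval g2 gE gv gD].
- by have [] := H1_deriv_itv_Re (fH e).
- by have [] := H1_deriv_itv_Re (fH e).
- by rewrite fs ft.
have /(congr1 (@complex.Re R)) := test g g1 gval g2 gE gv gD.
rewrite /L2_inner !Re_sum mulr_sumr => e; transitivity (\sum_e0 complex.Re (cintegral `[0, len e0] (fun x => f1 e0 x * (g1 e0 x)%:C^*))).
  by apply: eq_bigr => e1 _ /=; apply: eq_itvint => x _; rewrite Re_mulJ.
rewrite e; apply: eq_bigr => e1 _ /=; rewrite -itvintZ.
  apply: eq_itvint => x _; rewrite Re_mulJ mulrA; congr (_ * _).
  by case: (f e1 x) => a b /=; ring.
have [f2 fE] := H1_deriv_itv_Re (fH e1).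
apply: continuous_itv_integrable; apply: within_continuousM.
  by apply: primitive_continuous fE; rewrite ?ltW ?len_gt0//; exact: square_integrable_integrable.
by apply: primitive_continuous (gE e1); rewrite ?ltW ?len_gt0//; exact: square_integrable_integrable.
Qed.

End WeakEigenfunction.

Section Tent.
Context {R : realType}.
Implicit Types (l t x : R) (q : R -> R).

(** The Green function of - d^2/dx^2 on [0, l] with Dirichlet conditions and pole [t]: integrating
    [q * tent1] over the edge evaluates a primitive of [q] at [t], up to a term linear in [t]. *)
Definition tent l t x := Num.min x t - t / l * x.
Definition tent1 l t x : R := (x <= t)%R%:R - t / l.

Lemma itvint_le_indic x t q :
  itvint 0 x (fun y => q y * (y <= t)%R%:R) = itvint 0 (Num.min x t) q.
Proof.
have -> : itvint 0 x (fun y => q y * (y <= t)%R%:R) =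
    itvint 0 x (q \_ `[0, t]).
  apply: eq_itvint => y; rewrite in_itv/= => /andP[y0 _].
  rewrite patchE mem_setE in_itv/= y0 /=.
  by case: (y <= t)%R; rewrite ?mulr1 ?mulr0.
rewrite /itvint -Rintegral_mkcondr; congr Rintegral.
apply/seteqP; split => y /=; rewrite !in_itv/= le_min.
  by move=> [/andP[-> ->] /andP[_ ->]].
by move=> /and3P[-> -> ->].
Qed.

Lemma square_integrable_tent1 l t : itv_square_integrable l (tent1 l t).
Proof.
apply: (@bounded_square_integrable _ _ _ (1 + `|t / l|)).
  apply: measurable_funB => //.
  have -> : (fun x : R => (x <= t)%R%:R : R) = \1_(`]-oo, t]).
    by apply/funext => x; rewrite indicE mem_setE in_itv/=.
  exact: measurable_indic.
move=> x _; apply: le_trans (ler_normB _ _) _.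
by rewrite lerD2r; case: (x <= t)%R; rewrite ?normr1 ?normr0.
Qed.

Lemma itvint_tent1 l t x q : 0 <= x -> x <= l -> itv_square_integrable l q ->
  itvint 0 x (fun y => q y * tent1 l t y) =
  itvint 0 (Num.min x t) q - t / l * itvint 0 x q.
Proof.
move=> x0 xl q2; have qi := square_integrable_integrable q2.
have qi' : itv_integrable 0 x q by exact: itv_integrableS qi.
have qt : itv_integrable 0 x (fun y => q y * tent1 l t y).
  exact: itv_integrableS (square_integrableM q2 (square_integrable_tent1 l t)).
rewrite -itvint_le_indic -itvintZ// -itvintB//; last 2 first.
- apply: eq_integrable (itv_integrableD qt (itv_integrableZ (t / l) qi')) => //.
  by move=> y _ /=; congr EFin; rewrite /tent1; ring.
- exact: itv_integrableZ.
by apply: eq_itvint => y _; rewrite /tent1; ring.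
Qed.

Lemma tent_primitive l t : 0 <= t -> primitive_of l (tent l t) (tent1 l t).
Proof.
move=> t0 x; rewrite in_itv/= => /andP[x0 xl].
have := @itvint_tent1 l t x (fun=> 1) x0 xl.
have -> : itvint 0 x (fun y => 1 * tent1 l t y) = itvint 0 x (tent1 l t).
  by apply: eq_itvint => y _; rewrite mul1r.
move=> ->; last by apply: continuous_square_integrable => y; exact: cvg_cst.
rewrite !itvint_cst ?le_min ?x0// /tent [Num.min 0 t]min_l//; ring.
Qed.

End Tent.

Section WeakEigenfunctionRegularity.
Local Open Scope complex_scope.
Context {R : realType} (G : metric_graph R) (VD : {set vertex G}) (mu : R).
Variables (u u1 : edge G -> R -> R) (uval : vertex G -> R).
Hypothesis uP : weak_eigenfunction VD mu u u1 uval.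

(* Testing with [tent] on a single edge shows that
   [u + mu * (second antiderivative of u)] is affine there. *)
Lemma weak_eigenfunction_smooth e : exists U U1 : R -> R,
  [/\ forall x, x \in `[0, len e] -> u e x = U x,
      derivative_on 0 (len e) U U1 &
      derivative_on 0 (len e) U1 (fun x => - mu * U x)].
Proof.
have [u2 uE uv uD uw] := uP.
have l0 := len_gt0 e; set l := len e in l0 *.
have u1i := square_integrable_integrable (u2 e).
have cu : {within `[0, l], continuous (u e)} := primitive_continuous (ltW l0) u1i (uE e).
have [P dP] := continuous_antiderivative (ltW l0) cu.
have cP := der_within dP.
have [Q dQ] := continuous_antiderivative (ltW l0) cP.
have affine t : t \in `[0, l] ->
    u e t + mu * (Q t - Q 0) = u e 0 + t / l * (u e l - u e 0 + mu * (Q l - Q 0)).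
  move=> tl; have := tl; rewrite in_itv/= => /andP[t0 tle].
  pose h := tent l t; pose h1 := tent1 l t.
  have h2 : itv_square_integrable l h1 by exact: square_integrable_tent1.
  have hE : primitive_of l h h1 by exact: tent_primitive.
  have split_int (q : R -> R) : itv_square_integrable l q ->
      itvint 0 l (fun x => q x * h1 x) = itvint 0 t q - t / l * itvint 0 l q.
    by move=> q2; rewrite itvint_tent1 ?(ltW l0)// min_r.
  pose g := fun e' : edge G => if e' == e then h else fun=> 0.
  pose g1 := fun e' : edge G => if e' == e then h1 else fun=> 0.
  have hl : h l = 0.
    by rewrite /h /tent min_r// divfK ?subrr// gt_eqF.
  have h0 : h 0 = 0 by rewrite /h /tent min_l// mulr0 subr0.
  have offe (e' : edge G) (q q1 : R -> R) : e' != e ->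
      itvint 0 (len e') (fun x => q x * (if e' == e then q1 else fun=> 0) x) = 0.
    move=> /negbTE ne; rewrite ne -[RHS](itvint0 0 (len e')).
    by apply: eq_itvint => x _; rewrite mulr0.
  have E : itvint 0 l (fun x => u1 e x * h1 x) = mu * itvint 0 l (fun x => u e x * h x).
    have := uw g g1 (fun=> 0).
    rewrite (bigD1 e)//= [X in _ + X = _]big1; last by move=> e'; exact: offe.
    rewrite (bigD1 e)//= [X in _ = _ * (_ + X)]big1; last by move=> e'; exact: offe.
    rewrite /g /g1 eqxx !addr0 -/l; apply=> // e'; case: eqVneq => [->|_]//.
    - exact: square_integrable0.
    - by move=> x _; rewrite itvint0 addr0.
  have IP := integration_by_parts_primitive (ltW l0) cu (primitive_FTC dP cu) h2 hE.
  have P2 : itv_square_integrable l P by exact: continuous_square_integrable.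
  rewrite hl h0 !mulr0 subrr (split_int P P2) in IP.
  rewrite (split_int _ (u2 e)) in E.
  have Pi := continuous_itv_integrable cP.
  have QP := primitive_FTC dQ cP.
  rewrite -(primitive_incr Pi QP (lexx 0) t0 tle) in IP.
  rewrite -(primitive_incr Pi QP (lexx 0) (ltW l0) (lexx l)) in IP.
  rewrite -(primitive_incr u1i (uE e) (lexx 0) t0 tle) in E.
  rewrite -(primitive_incr u1i (uE e) (lexx 0) (ltW l0) (lexx l)) in E.
  move: IP => /eqP; rewrite addr_eq0 => /eqP IP.
  have -> : u e t = u e 0 + t / l * (u e l - u e 0) + (u e t - u e 0 - t / l * (u e l - u e 0)) by ring.
  rewrite E; have -> : mu * itvint 0 l (fun x => u e x * h x) = - mu * (Q t - Q 0 - t / l * (Q l - Q 0)).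
    by rewrite IP; ring.
  by ring.
pose c := (u e l - u e 0 + mu * (Q l - Q 0)) / l.
exists (fun x => u e 0 + c * x - mu * (Q x - Q 0)), (fun x => c - mu * P x).
have uU x : x \in `[0, l] -> u e x = u e 0 + c * x - mu * (Q x - Q 0).
  by move=> /affine xl; rewrite -[LHS](addrK (mu * (Q x - Q 0))) xl /c; ring.
split; first exact: uU.
  move=> x xl; apply: is_derive_eq (derB (derD (der_cst (u e 0) x) (derMc c x))
    (derM (der_cst mu x) (derB (dQ x xl) (der_cst (Q 0) x)))) _.
  by ring.
move=> x xl; apply: is_derive_eq (derB (der_cst c x) (derM (der_cst mu x) (dP x xl))) _.
by rewrite -uU//; ring.
Qed.

Lemma weak_eigenfunction_classical : exists U U1 : edge G -> R -> R,
  [/\ forall e x, x \in `[0, len e] -> u e x = U e x,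
      forall e, derivative_on 0 (len e) (U e) (U1 e),
      forall e, derivative_on 0 (len e) (U1 e) (fun x => - mu * U e x) &
      forall w, w \notin VD ->
        flux src tgt (fun e => U1 e 0) (fun e => U1 e (len e)) w = 0].
Proof.
have [u2 uE uv uD uw] := uP.
have [U /choice[U1 UP]] := choice weak_eigenfunction_smooth.
exists U, U1; split.
- by move=> e; have [] := UP e.
- by move=> e; have [] := UP e.
- by move=> e; have [] := UP e.
move=> w wD; have l0 (e : edge G) : len e != 0 by rewrite gt_eqF// len_gt0.
(* The test function [g] is affine on every edge, with value 1 at [w] and 0 at the other vertices.
   On a loop at [w] it is constant. After integration by parts only the flux at [w] is left. *)
pose c (e : edge G) : R := ((tgt e == w)%:R - (src e == w)%:R) / len e.
pose g (e : edge G) x : R := (src e == w)%:R + c e * x.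
have gE e : primitive_of (len e) (g e) (fun=> c e).
  move=> x; rewrite in_itv/= => /andP[x0 _]; rewrite itvint_cst// /g; ring.
have c2 e : itv_square_integrable (len e) (fun=> c e).
  by apply: continuous_square_integrable => x; exact: cvg_cst.
have gv e : g e 0 = (src e == w)%:R /\ g e (len e) = (tgt e == w)%:R.
  rewrite /g /c; split; first ring.
  by field; exact: l0.
have gD z : z \in VD -> (z == w)%:R = 0 :> R.
  by move=> zD; case: eqP => // zw; rewrite -zw zD in wD.
have := uw g (fun e _ => c e) (fun z => (z == w)%:R) c2 gE gv gD.
move=> /eqP; rewrite mulr_sumr -subr_eq0 -sumrB => /eqP e0.
apply/eqP; rewrite -oppr_eq0; apply/eqP; rewrite -[RHS]e0 /flux -sumrN.
apply: eq_bigr => e _; have [uU dU dU1] := UP e.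
have [g0 gl] := gv e; have le0 := ltW (len_gt0 e).
have cU1 := der_within dU1; have cU := der_within dU.
have cF : {within `[0, len e], continuous (fun x => - mu * U e x)}.
  by apply: within_continuousM => // x; exact: cvg_cst.
have u1i := square_integrable_integrable (u2 e).
have IP := integration_by_parts_primitive le0 cF (primitive_FTC dU1 cF) (c2 e) (gE e).
rewrite g0 gl in IP.
have -> : itvint 0 (len e) (fun x => u1 e x * c e) = itvint 0 (len e) (fun x => U1 e x * c e).
  transitivity (c e * itvint 0 (len e) (u1 e)).
    by rewrite -itvintZ//; apply: eq_itvint => x _; rewrite mulrC.
  rewrite -(primitive_incr u1i (uE e) (lexx 0) le0 (lexx _)).
  rewrite !uU ?edge0 ?edge_len//.
  rewrite (primitive_incr (continuous_itv_integrable cU1) (primitive_FTC dU cU1) (lexx 0) le0 (lexx _)).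
  rewrite -itvintZ; last exact: continuous_itv_integrable.
  by apply: eq_itvint => x _; rewrite mulrC.
have -> : mu * itvint 0 (len e) (fun x => u e x * g e x) =
    - itvint 0 (len e) (fun x => - mu * U e x * g e x).
  rewrite -mulN1r -!itvintZ.
  - by apply: eq_itvint => x xl; rewrite uU//; ring.
  - apply: continuous_itv_integrable; apply: within_continuousM => //.
    by apply: primitive_continuous (gE e) => //; exact: itv_integrable_cst.
  - apply: continuous_itv_integrable; apply: within_continuousM.
      exact: primitive_continuous (uE e).
    by apply: primitive_continuous (gE e) => //; exact: itv_integrable_cst.
by rewrite opprK IP; ring.
Qed.

Lemma connect_invariant (h : vertex G -> R) :
  (forall e, h (src e) = h (tgt e)) -> forall w z, h w = h z.
Proof.
move=> he w z; have /connectP[p] := graph_connected w z.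
elim: p w => [|y p IH] w /=; first by move=> _ ->.
move=> /andP[/existsP[e /orP[]/andP[/eqP <- /eqP <-]]] pp zE.
  by rewrite he (IH _ pp zE).
by rewrite -he (IH _ pp zE).
Qed.

(** If [mu <= 0], then U U' is nondecreasing on each edge, while its increments add up to 0 by the
    vertex conditions. Hence U' = 0, so U is constant on the connected graph and equals its
    Dirichlet value 0. Positivity is what allows [mu] to be written as a square. *)
Lemma weak_eigenvalue_gt0 : (exists w, w \in VD) ->
  (exists e (x : R), x \in `[0, len e] /\ u e x != 0) -> 0 < mu.
Proof.
move=> [w0 w0D] [e0 [x0 [x0l ux0]]]; have [_ _ uv uD _] := uP.
have [U [U1 [uU dU dU1 kirch]]] := weak_eigenfunction_classical.
rewrite ltNge; apply/negP => mu0.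
pose N e x := U e x * U1 e x.
pose N1 e x := U e x * (- mu * U e x) + U1 e x * U1 e x.
have dN e : derivative_on 0 (len e) (N e) (N1 e).
  by move=> x xl; exact: derM (dU e x xl) (dU1 e x xl).
have N1E e x : N1 e x = - mu * U e x ^+ 2 + U1 e x ^+ 2 by rewrite /N1; ring.
have N1ge e x : 0 <= N1 e x.
  by rewrite N1E addr_ge0 ?sqr_ge0// mulr_ge0 ?sqr_ge0// oppr_ge0.
have le0 (e : edge G) : 0 <= len e by exact: ltW (len_gt0 e).
have Nge e : 0 <= N e (len e) - N e 0.
  rewrite subr_ge0.
  exact: (@der_ge0_le _ (N e) (N1 e) 0 (len e) (le0 e) (dN e) (fun x _ => N1ge e x)).
have Nsum : \sum_e (N e (len e) - N e 0) = 0.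
  rewrite -[LHS]opprK -[RHS]oppr0; congr (- _); rewrite -sumrN.
  transitivity (\sum_e (uval (src e) * U1 e 0 - uval (tgt e) * U1 e (len e))).
    apply: eq_bigr => e _; have [<- <-] := uv e.
    by rewrite !uU ?edge0 ?edge_len// opprB.
  rewrite sum_flux big1// => w _.
  by have [/uD ->|/kirch ->] := boolP (w \in VD); rewrite ?mul0r ?mulr0.
have N0 e : N e (len e) - N e 0 = 0.
  apply/eqP; move/eqP: Nsum; rewrite psumr_eq0; last by move=> i _; exact: Nge.
  by move=> /allP /(_ e); rewrite mem_index_enum; exact.
have U10 e x : x \in `]0, len e[ -> U1 e x = 0.
  move=> xl; have : N1 e x = 0.
    apply: (der_ge0_eq0 (dN e)) xl; first by move=> y _; exact: N1ge.
    by rewrite -subr_le0 N0.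
  rewrite N1E => /eqP; rewrite paddr_eq0; last 2 first.
  - by rewrite mulr_ge0 ?oppr_ge0 ?sqr_ge0.
  - exact: sqr_ge0.
  by move=> /andP[_]; rewrite sqrf_eq0 => /eqP.
have Ucst e x : x \in `[0, len e] -> U e x = uval (src e).
  rewrite in_itv/= => /andP[x00 xle]; have [<- _] := uv e.
  rewrite uU ?edge0//; apply/esym/(@der0_eq _ _ (U1 e) 0 x x00).
    move=> y; rewrite in_itv/= => /andP[y0 yx]; apply: dU.
    by rewrite in_itv/= y0 (le_trans yx).
  move=> y; rewrite in_itv/= => /andP[y0 yx]; apply: U10.
  by rewrite in_itv/= y0 (lt_le_trans yx).
have uvc : forall e, uval (src e) = uval (tgt e).
  by move=> e; have [_ <-] := uv e; rewrite uU ?edge_len// Ucst ?edge_len.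
move: ux0; rewrite uU// Ucst// (connect_invariant uvc _ w0) uD// eqxx.
by [].
Qed.

Lemma weak_eigenfunction_system : (exists w, w \in VD) ->
  (exists e (x : R), x \in `[0, len e] /\ u e x != 0) ->
  exists k A B val, [/\ 0 < k, mu = k ^+ 2,
    trig_system src tgt len VD k A B val & nontrivial A B].
Proof.
move=> w0 unz; have mu0 := weak_eigenvalue_gt0 w0 unz.
have [_ _ uv uD _] := uP.
have [U [U1 [uU dU dU1 kirch]]] := weak_eigenfunction_classical.
pose k := Num.sqrt mu; have k0 : 0 < k by rewrite sqrtr_gt0.
have kE : mu = k ^+ 2 by rewrite sqr_sqrtr// ltW.
have sol e : exists AB : R * R, forall x, x \in `[0, len e] ->
    U e x = trig k AB.1 AB.2 x /\ U1 e x = k * trig k AB.2 (- AB.1) x.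
  have dU1e : derivative_on 0 (len e) (U1 e) (fun x => - k ^+ 2 * U e x).
    by rewrite -kE; exact: dU1.
  have [A [B AB]] := harmonic_trig k0 (ltW (len_gt0 e)) (dU e) dU1e.
  by exists (A, B).
have [AB ABP] := choice sol.
exists k, (fun e => (AB e).1), (fun e => (AB e).2), uval; split => //.
  split => //.
  - by move=> e; have [<- _] := uv e; rewrite uU ?edge0// (ABP e 0 (edge0 e)).1 trig0.
  - by move=> e; have [_ <-] := uv e; rewrite uU ?edge_len// (ABP e _ (edge_len e)).1.
  - move=> w /kirch; rewrite /flux => e0; apply: (mulfI (lt0r_neq0 k0)).
    rewrite mulr0 -[RHS]e0 mulr_sumr; apply: eq_bigr => e _.
    rewrite (ABP e 0 (edge0 e)).2 (ABP e _ (edge_len e)).2 trig0; ring.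
have [e [x [xl]]] := unz; rewrite uU// (ABP e x xl).1 => tn0; exists e.
apply: contraNT tn0; rewrite negb_or !negbK => /andP[/eqP -> /eqP ->].
by rewrite /trig !mul0r addr0.
Qed.

End WeakEigenfunctionRegularity.

Lemma eigenvalue_system (R : realType) (G : metric_graph R) (VD : {set vertex G}) (mu : R) :
  (exists w, w \in VD) -> graph_eigenvalue VD mu ->
  exists k A B val, [/\ 0 < k, mu = k ^+ 2,
    trig_system src tgt len VD k A B val & nontrivial A B].
Proof.
move=> w0 /eigenvalue_weak[u [u1 [uval [uP unz]]]].
exact: weak_eigenfunction_system uP w0 unz.
Qed.

(** * Shooting from the leaves of a rooted tree *)

(* [pa e] and [ch e] are the ends of [e] towards and away from the root [v]. *)
Record rooted_tree (V E : finType) (v : V) (pa ch : E -> V) (hop : V -> nat) := RootedTree {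
  ch_inj : injective ch;
  ch_root : forall e, ch e != v;
  ch_surj : forall u, u != v -> exists e, ch e = u;
  hop_ch : forall e, hop (ch e) = (hop (pa e)).+1 }.

Section RootedTree.
Context {V E : finType} {v : V} {pa ch : E -> V} {hop : V -> nat}.
Hypothesis treeP : rooted_tree v pa ch hop.

Lemma tree_vertexP u : u = v \/ exists e, ch e = u.
Proof.
by have [->|/(ch_surj treeP) ?] := eqVneq u v; [left|right].
Qed.

Lemma tree_ind_down (P : V -> Prop) :
  P v -> (forall e, P (pa e) -> P (ch e)) -> forall u, P u.
Proof.
move=> Pv Pe u; have [n] := ubnP (hop u); elim: n u => // n IH u un.
have [->//|[e eu]] := tree_vertexP u; rewrite -eu; apply: Pe; apply: IH.
by move: un; rewrite -eu (hop_ch treeP).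
Qed.

Lemma hop_root u : (hop v <= hop u)%N.
Proof. by elim/tree_ind_down: u => // e ve; rewrite (hop_ch treeP) leqW. Qed.

Lemma hop_bound : exists N, forall u, (hop u < N)%N.
Proof.
exists (\max_u hop u).+1 => u; rewrite ltnS; exact: leq_bigmax.
Qed.

Lemma tree_ind_up (P : E -> Prop) :
  (forall e, (forall c, pa c = ch e -> P c) -> P e) -> forall e, P e.
Proof.
move=> Pe e; have [N hN] := hop_bound.
have [n] := ubnP (N - hop (pa e))%N; elim: n e => // n IH e en; apply: Pe => c ce.
apply: IH; rewrite ce (hop_ch treeP); have := hN (pa e); lia.
Qed.

Lemma tree_rec_down (T : Type) (x0 : T) (F : E -> T -> T) :
  exists X : V -> T, X v = x0 /\ forall e, X (ch e) = F e (X (pa e)).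
Proof.
have [N hN] := hop_bound.
suff [X [Xv XE]] : exists X : V -> T, X v = x0 /\
    forall e, (hop (pa e) < N)%N -> X (ch e) = F e (X (pa e)).
  by exists X; split => // e; apply: XE; exact: hN.
elim: N {hN} => [|n [X [Xv XE]]]; first by exists (fun=> x0).
pose X' u := if [pick e | ch e == u] is Some e then F e (X (pa e)) else x0.
have X'v : X' v = x0.
  rewrite /X'; case: pickP => // e /eqP ev.
  by have := ch_root treeP e; rewrite ev eqxx.
have X'ch e : X' (ch e) = F e (X (pa e)).
  rewrite /X'; case: pickP => [e' /eqP/(ch_inj treeP) -> //|/(_ e)].
  by rewrite eqxx.
exists X'; split => // e en; rewrite X'ch; congr (F e _).
have [->|[e' e'E]] := tree_vertexP (pa e); first by rewrite X'v.
rewrite -e'E X'ch XE//; move: en; rewrite -e'E (hop_ch treeP); lia.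
Qed.

(** [F] receives the whole function but depends only on the children, so each further application of
    [F] makes the equation hold one level closer to the root. *)
Lemma tree_rec_up (T : Type) (x0 : T) (F : E -> (E -> T) -> T) :
  (forall e f g, (forall c, pa c = ch e -> f c = g c) -> F e f = F e g) ->
  exists Y : E -> T, forall e, Y e = F e Y.
Proof.
move=> Fext; have [N hN] := hop_bound.
suff [Y YE] : exists Y : E -> T, forall e, (N - hop (pa e) <= N)%N -> Y e = F e Y.
  by exists Y => e; apply: YE; rewrite leq_subr.
elim: {2}N => [|n [Y YE]].
  by exists (fun=> x0) => e; have := hN (pa e); lia.
exists (fun e => F e Y) => e en; apply: Fext => c ce; apply: YE.
rewrite ce (hop_ch treeP); have := hN (pa e); lia.
Qed.

Context {R : realType}.

(** Edges are grouped by their upper end, and the vertices other than the root are indexed by the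
    unique edge above them. *)
Lemma sum_children (T : E -> R) :
  \sum_c T c = \sum_(c | pa c == v) T c + \sum_e \sum_(c | pa c == ch e) T c.
Proof.
rewrite (partition_big pa predT)//= (bigD1 v)//=; congr (_ + _).
rewrite -(big_imset (fun w => \sum_(c | pa c == w) T c) (in2W (ch_inj treeP)))/=.
apply: eq_bigl => w; apply/idP/imsetP => [/(ch_surj treeP)[e <-]|[e _ ->]].
  by exists e.
exact: ch_root treeP e.
Qed.

Lemma flux_ch (a b : E -> R) e :
  flux pa ch a b (ch e) = \sum_(c | pa c == ch e) a c - b e.
Proof.
rewrite /flux sumrB [in RHS]big_mkcond/=; congr (_ - _).
  by apply: eq_bigr => c _; case: eqP => _; rewrite ?mul1r ?mul0r.
rewrite (bigD1 e)//= eqxx mul1r big1 ?addr0// => c.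
by rewrite -(inj_eq (ch_inj treeP)) => /negbTE ->; rewrite mul0r.
Qed.

Lemma flux_root (a b : E -> R) : flux pa ch a b v = \sum_(c | pa c == v) a c.
Proof.
rewrite /flux [in RHS]big_mkcond/=; apply: eq_bigr => c _.
by rewrite (negbTE (ch_root treeP c)) mul0r subr0; case: eqP => _; rewrite ?mul1r ?mul0r.
Qed.

Definition terminal e := [forall c, pa c != ch e].

Lemma terminalN e : ~~ terminal e -> exists c, pa c = ch e.
Proof. by rewrite negb_forall => /existsP[c]; rewrite negbK => /eqP; exists c. Qed.

End RootedTree.
Arguments terminal {V E} pa ch e.

Lemma left_limit_ge0 (R : realType) (f : R -> R) a x : a < x -> {for x, continuous f} ->
  (forall y, a < y -> y < x -> 0 <= f y) -> 0 <= f x.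
Proof.
move=> ax cf fge0; have fx : f @ x^'- --> f x by exact: cvg_at_left_filter.
rewrite -(cvg_lim _ fx)//; apply: limr_ge; first by apply/cvg_ex; exists (f x).
near=> y; apply: fge0; near: y; [exact: nbhs_left_gt|exact: nbhs_left_lt].
Unshelve. all: by end_near. Qed.

Section Shooting.
Context {R : realType} {V E : finType} {v : V} (pa ch : E -> V) {hop : V -> nat}.
Hypothesis treeP : rooted_tree v pa ch hop.
Variables (l : E -> R) (dist : V -> R).
Hypothesis l_gt0 : forall e, 0 < l e.
Hypothesis dist_root : dist v = 0.
Hypothesis dist_ch : forall e, dist (ch e) = dist (pa e) + l e.

Lemma dist_ge0 u : 0 <= dist u.
Proof.
elim/(tree_ind_down treeP): u => [|e]; first by rewrite dist_root.
by rewrite dist_ch => d0; rewrite addr_ge0// ltW.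
Qed.

Lemma dist_ch_gt0 e : 0 < dist (ch e).
Proof. by rewrite dist_ch ltr_wpDl ?dist_ge0. Qed.

(* Solutions of [w'' = - k ^+ 2 * w] started at the leaves and propagated
   towards the root. At the lower end of [e] they have the value
   [low_val e] and the derivative [k * low_der e k], at the upper end the
   value [top_val e k] and the derivative [k * top_der e k];
   [q] is [top_der / top_val]. *)
Variable q : E -> R -> R.

(** Each edge has its own normalisation: value 0 and slope 1 at a leaf, value 1 at any other lower
    end. The scaling is irrelevant because the edges communicate only through [q]; where [top_val]
    is 0, [q] takes the conventional value 0 and carries no meaning. *)
Definition low_val e : R := (~~ terminal pa ch e)%:R.
Definition low_der e k : R :=
  if terminal pa ch e then 1 else \sum_(c | pa c == ch e) q c k.
Definition top_val e k := trig k (low_val e) (low_der e k) (l e).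
Definition top_der e k := trig k (low_der e k) (- low_val e) (l e).

Hypothesis qE : forall e k, q e k = top_der e k / top_val e k.

(** Below length [pi / k], positivity at the upper end controls the whole edge, so positivity need
    not be required at every point. *)
Definition edge_good e k := (k * l e < pi) && (0 < top_val e k).
Definition good k := forall e, edge_good e k.

Lemma low_val_terminal e : terminal pa ch e -> low_val e = 0.
Proof. by rewrite /low_val => ->. Qed.

Lemma low_val_nonterminal e : ~~ terminal pa ch e -> low_val e = 1.
Proof. by rewrite /low_val => ->. Qed.

Lemma low_val_ge0 e : 0 <= low_val e.
Proof. by rewrite /low_val ler0n. Qed.

Lemma low_nonzero e k : low_val e = 0 -> low_der e k = 0 -> False.
Proof.
rewrite /low_val /low_der; case: (terminal pa ch e) => /= e1 e2.
  by move/eqP: e2; rewrite oner_eq0.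
by move/eqP: e1; rewrite oner_eq0.
Qed.

(* Comparison with [sin (k * (D - dist))], which is positive below distance [D]. *)
Lemma small_good D k : (forall u, dist u <= D) -> 0 < k -> k * D < pi / 2 -> good k.
Proof.
move=> dD k0 kD.
pose th u := k * (D - dist u).
have th0 u : 0 <= th u by rewrite mulr_ge0 ?(ltW k0)// subr_ge0.
have thE e : th (pa e) = th (ch e) + k * l e by rewrite /th dist_ch; ring.
have kl0 e : 0 < k * l e by rewrite mulr_gt0.
have thpi u : th u < pi / 2.
  by apply: le_lt_trans kD; rewrite /th ler_pM2l// gerBl dist_ge0.
have cth u : 0 < cos (th u).
  by apply: cos_gt0_pihalf; rewrite thpi (lt_le_trans _ (th0 u))// oppr_lt0 divr_gt0 ?pi_gt0.
have sth e : 0 < sin (th (pa e)).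
  by apply: sin_gt0_pihalf; rewrite thpi andbT thE ltr_wpDl.
have klpi e : k * l e < pi / 2.
  by apply: le_lt_trans (thpi (pa e)); rewrite thE lerDr.
(* The invariant says that [q] is at least the cotangent of [th], the logarithmic derivative of the
   comparison function. It is carried along an edge by the Wronskian, which is constant, and at a
   vertex it is enough to keep one child. *)
suff H e : edge_good e k /\ cos (th (pa e)) <= q e k * sin (th (pa e)).
  by move=> e; have [] := H e.
elim/(tree_ind_up treeP): e => e IH.
have low : low_val e * cos (th (ch e)) <= low_der e k * sin (th (ch e)) /\ 0 <= low_der e k.
  have [te|te] := boolP (terminal pa ch e).
    rewrite low_val_terminal// /low_der te mul0r mul1r sin_ge0_pi//.
    by rewrite th0 ltW// (lt_trans (thpi _))// ltr_pdivrMr// ltr_pMr ?pi_gt0// ltr1n.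
  have [c ce] := terminalN te.
  have qc c' : pa c' == ch e -> 0 <= q c' k.
    move=> /eqP c'e; have [_ qc'] := IH c' c'e.
    have := lt_le_trans (cth _) qc'; rewrite pmulr_lgt0//; exact: ltW.
  have le : q c k <= low_der e k.
    by rewrite /low_der (negbTE te) (bigD1 c) ?ce//= lerDl sumr_ge0// => c' /andP[/qc].
  have [_ qcE] := IH c ce; rewrite ce in qcE.
  rewrite low_val_nonterminal// mul1r; split.
    apply: le_trans qcE _; rewrite ler_wpM2r//.
    by rewrite -ce ltW// sth.
  by apply: le_trans le; apply: qc; rewrite ce.
have [low1 low2] := low.
have sl : 0 < sin (k * l e) by apply: sin_gt0_pihalf; rewrite kl0 klpi.
have cl : 0 < cos (k * l e).
  by apply: cos_gt0_pihalf; rewrite klpi (lt_trans _ (kl0 e))// oppr_lt0 divr_gt0 ?pi_gt0.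
have W0 : 0 < top_val e k.
  rewrite /top_val /trig; have [te|te] := boolP (terminal pa ch e).
    by rewrite low_val_terminal// /low_der te mul0r mul1r add0r.
  by rewrite low_val_nonterminal// mul1r ltr_pwDl// mulr_ge0// ltW.
split.
  apply/andP; split => //; apply: lt_trans (klpi e) _.
  by rewrite ltr_pdivrMr// ltr_pMr ?pi_gt0// ltr1n.
rewrite qE mulrAC ler_pdivlMr// -subr_ge0 thE.
have -> : top_der e k * sin (th (ch e) + k * l e) - cos (th (ch e) + k * l e) * top_val e k =
    (low_der e k * sin (th (ch e)) - low_val e * cos (th (ch e))) *
    (cos (k * l e) ^+ 2 + sin (k * l e) ^+ 2).
  by rewrite /top_der /top_val /trig sinD cosD; ring.
by rewrite cos2Dsin2 mulr1 subr_ge0.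
Qed.

Lemma trig_continuous_param (a : R) (b : R -> R) (x k1 : R) :
  {for k1, continuous b} -> {for k1, continuous (fun k => trig k a (b k) x)} /\
  {for k1, continuous (fun k => trig k (b k) (- a) x)}.
Proof.
move=> cb; have ck : {for k1, continuous (fun k : R => k * x)}.
  by apply: continuousM; [exact: cvg_id|exact: cvg_cst].
have cc : {for k1, continuous (fun k : R => cos (k * x))}.
  by apply: continuous_comp ck _; exact: continuous_cos.
have cs : {for k1, continuous (fun k : R => sin (k * x))}.
  by apply: continuous_comp ck _; exact: continuous_sin.
by split; apply: continuousD; apply: continuousM => //; exact: cvg_cst.
Qed.

(** [low_der e] divides only by [top_val] of edges farther from the root. Thus continuity survives
    at a frequency where [top_val e] itself vanishes, which is where it is needed. *)
Lemma low_der_continuous k1 e :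
  (forall c, (hop (pa e) < hop (pa c))%N -> top_val c k1 != 0) ->
  {for k1, continuous (low_der e)}.
Proof.
elim/(tree_ind_up treeP): e => e IH W0.
have -> : low_der e = if terminal pa ch e then fun=> 1
    else fun k => \sum_(c | pa c == ch e) q c k.
  by apply/funext => k; rewrite /low_der; case: ifP.
case: ifPn => te; first exact: cvg_cst.
have cq c : pa c = ch e -> {for k1, continuous (q c)}.
  move=> ce; have hc : (hop (pa e) < hop (pa c))%N by rewrite ce (hop_ch treeP).
  have cb : {for k1, continuous (low_der c)}.
    by apply: IH => // c' hc'; apply: W0; exact: ltn_trans hc'.
  have [cW cN] := trig_continuous_param (low_val c) (l c) cb.
  have -> : q c = (fun k => top_der c k / top_val c k) by apply/funext => k; rewrite qE.
  by apply: continuousM => //; apply: continuousV => //; exact: W0.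
have -> : (fun k => \sum_(c | pa c == ch e) q c k) = \sum_(c | pa c == ch e) q c.
  by apply/funext => k; rewrite fct_sumE.
apply: (big_ind (fun f : R -> R => {for k1, continuous f})) => [|f g cf cg|c /eqP].
- exact: cvg_cst.
- exact: continuousD.
- exact: cq.
Qed.

Lemma top_continuous k1 e :
  (forall c, (hop (pa e) < hop (pa c))%N -> top_val c k1 != 0) ->
  {for k1, continuous (top_val e)} /\ {for k1, continuous (top_der e)}.
Proof. by move=> W0; apply: trig_continuous_param; exact: low_der_continuous. Qed.

Lemma edge_good_sin e k : 0 < k -> edge_good e k -> 0 < sin (k * l e).
Proof. by move=> k0 /andP[kl _]; rewrite sin_gt0_pi// kl mulr_gt0. Qed.

Lemma xcot_le1 e k : 0 < k -> edge_good e k ->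
  cos (k * l e) / sin (k * l e) <= (k * l e)^-1.
Proof.
move=> k0 g; have s0 := edge_good_sin k0 g; have kl0 : 0 < k * l e by rewrite mulr_gt0.
rewrite ler_pdivrMr// ler_pdivlMl// xcos_le_sin//.
by rewrite ltW//=; have /andP[/ltW] := g.
Qed.

(** Comparison with the solution vanishing at the lower end: [top_der] is at most the cotangent of
    [k * l e] times [top_val], by the Wronskian of the two. *)
Lemma top_der_ub e k : 0 < k -> edge_good e k ->
  top_der e k <= (k * l e)^-1 * top_val e k.
Proof.
move=> k0 g; have s0 := edge_good_sin k0 g; have /andP[_ W0] := g.
apply: (@le_trans _ _ (cos (k * l e) / sin (k * l e) * top_val e k)); last first.
  by rewrite ler_wpM2r ?(ltW W0)// xcot_le1.
rewrite mulrAC ler_pdivlMr// -subr_ge0.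
have -> : cos (k * l e) * top_val e k - top_der e k * sin (k * l e) =
    low_val e * (cos (k * l e) ^+ 2 + sin (k * l e) ^+ 2).
  by rewrite /top_der /top_val /trig; ring.
by rewrite cos2Dsin2 mulr1 low_val_ge0.
Qed.

Lemma q_ub e k : 0 < k -> edge_good e k -> q e k <= (k * l e)^-1.
Proof.
move=> k0 g; have /andP[_ W0] := g.
by rewrite qE ler_pdivrMr// top_der_ub.
Qed.

(** The mirror comparison, with the solution vanishing at the upper end; it is a rearrangement of
    [0 < top_val e k]. *)
Lemma low_der_lb e k : 0 < k -> edge_good e k -> ~~ terminal pa ch e ->
  - (k * l e)^-1 <= low_der e k.
Proof.
move=> k0 g te; have s0 := edge_good_sin k0 g; have /andP[_ W0] := g.
apply: (@le_trans _ _ (- (cos (k * l e) / sin (k * l e)))).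
  by rewrite lerN2 xcot_le1.
rewrite -mulNr ler_pdivrMr// -subr_ge0 opprK addrC.
by move: W0; rewrite /top_val /trig low_val_nonterminal// mul1r => /ltW.
Qed.

Let Linv := \sum_e (l e)^-1.

Lemma Linv_ge e : (l e)^-1 <= Linv.
Proof.
rewrite /Linv (bigD1 e)//= lerDl sumr_ge0// => c _.
by rewrite invr_ge0 ltW.
Qed.

(* On a good frequency the slope below a non-root edge cannot be very
   negative, as the edge above it carries a positive solution. *)
Lemma q_lb e e' k : 0 < k -> good k -> pa e = ch e' -> - (2 * Linv / k) <= q e k.
Proof.
move=> k0 g ee'.
have te' : ~~ terminal pa ch e'.
  by rewrite negb_forall; apply/existsP; exists e; rewrite negbK ee'.
have := low_der_lb k0 (g e') te'.
rewrite /low_der (negbTE te') (bigD1 e) ?ee'//= => lb.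
have ub : \sum_(c | (pa c == ch e') && (c != e)) q c k <= Linv / k.
  apply: (@le_trans _ _ (\sum_c (l c)^-1 / k)).
    rewrite big_mkcond/=; apply: ler_sum => c _; case: ifP => _.
      by rewrite -invfM mulrC q_ub.
    by rewrite divr_ge0 ?invr_ge0 ?(ltW k0)// ltW.
  by rewrite -mulr_suml.
have le' : (k * l e')^-1 <= Linv / k.
  by rewrite invfM mulrC ler_wpM2r ?invr_ge0 ?(ltW k0)// Linv_ge.
have -> : - (2 * Linv / k) = - (Linv / k) - Linv / k by ring.
rewrite lerBlDr; apply: le_trans (lerD (lexx _) ub).
by apply: le_trans lb; rewrite lerN2.
Qed.

Hypothesis root_edge : forall e c, pa e = v -> pa c = v -> e = c.

(** Positivity is lost first at the root: on any other edge the solutions on the edge above bound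
    the slope from below, so the value could only reach 0 together with the slope. *)
Lemma first_bad_frequency k1 : 0 < k1 -> (forall k, 0 < k -> k < k1 -> good k) ->
  ~ good k1 -> exists e, [/\ pa e = v, top_val e k1 = 0 &
    forall c, c != e -> 0 < top_val c k1].
Proof.
move=> k10 gk /existsNP[e1 /negP be1].
(* A bad edge farthest from the root: every edge on which its data depend is good, so these are
   continuous at [k1]. *)
have [e be emax] := @arg_maxnP _ e1 (fun e => ~~ edge_good e k1) (fun e => hop (pa e)) be1.
have good_above c : (hop (pa e) < hop (pa c))%N -> edge_good c k1.
  by apply: contraTT => /emax; rewrite -leqNgt.
have [cW cN] : {for k1, continuous (top_val e)} /\ {for k1, continuous (top_der e)}.
  by apply: top_continuous => c /good_above /andP[_ /lt0r_neq0].
have W0 : 0 <= top_val e k1.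
  by apply: (left_limit_ge0 k10 cW) => k k0 kk1; have /andP[_ /ltW] := gk k k0 kk1 e.
have kl : k1 * l e <= pi.
  rewrite -subr_ge0; apply: (@left_limit_ge0 _ (fun k => pi - k * l e) 0) => //.
    apply: continuousB; first exact: cvg_cst.
    by apply: continuousM; [exact: cvg_id|exact: cvg_cst].
  by move=> k k0 kk1; rewrite subr_ge0; have /andP[/ltW] := gk k k0 kk1 e.
have {}W0 : top_val e k1 = 0.
  (* If [k1 * l e] reaches [pi], then [top_val] equals [- low_val], and being nonnegative it is 0 as
     well. *)
  move: be; rewrite negb_and -!leNgt => /orP[kl'|W0'].
    have {}kl : k1 * l e = pi by apply/eqP; rewrite eq_le kl.
    move: W0; rewrite /top_val /trig kl cospi sinpi mulr0 addr0 mulrN1 oppr_ge0 => a0.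
    have -> : low_val e = 0 by apply/eqP; rewrite eq_le a0 low_val_ge0.
    by rewrite oppr0.
  by apply/eqP; rewrite eq_le W0 W0'.
have [ev|[e' e'e]] := tree_vertexP treeP (pa e); last first.
  (* Below [k1] the quantity [k * top_der] lies between constant multiples of [top_val]. In the
     limit both vanish, which no nonzero solution allows. *)
  exfalso; have ck : {for k1, continuous (fun k : R => k)} by exact: cvg_id.
  have N1 : 0 <= (l e)^-1 * top_val e k1 - k1 * top_der e k1.
    apply: (@left_limit_ge0 _ (fun k => (l e)^-1 * top_val e k - k * top_der e k) 0) => //.
      by apply: continuousB; apply: continuousM => //; exact: cvg_cst.
    move=> k k0 kk1; rewrite subr_ge0 -ler_pdivlMl// mulrA -invfM.
    exact: top_der_ub (gk k k0 kk1 e).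
  have N2 : 0 <= k1 * top_der e k1 + 2 * Linv * top_val e k1.
    apply: (@left_limit_ge0 _ (fun k => k * top_der e k + 2 * Linv * top_val e k) 0) => //.
      by apply: continuousD; apply: continuousM => //; exact: cvg_cst.
    move=> k k0 kk1; have g := gk k k0 kk1; have /andP[_ Wk] := g e.
    have := q_lb k0 g (esym e'e); rewrite qE ler_pdivlMr// mulNr mulrAC -mulNr ler_pdivrMr//.
    by rewrite -subr_ge0 opprK [top_der e k * k]mulrC.
  move: N1 N2; rewrite W0 !mulr0 add0r addr0 oppr_ge0 => N1 N2.
  have /eqP : k1 * top_der e k1 = 0 by apply/eqP; rewrite eq_le N1 N2.
  rewrite mulf_eq0 gt_eqF//= => /eqP N0.
  have [a0 b0] := trig_eq0 W0 N0; exact: low_nonzero a0 b0.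
exists e; split => // c ce; have [cv|[c' c'c]] := tree_vertexP treeP (pa c).
  by move/eqP: ce; case; exact: root_edge.
have /andP[//] : edge_good c k1.
apply: good_above; rewrite -c'c (hop_ch treeP) ltnS.
by rewrite ev (hop_root treeP).
Qed.

Lemma good_open k1 : 0 < k1 -> good k1 -> \forall k \near k1, good k.
Proof.
move=> k10 g; apply: (@filter_forall _ E (fun e => [set k | edge_good e k]) (nbhs k1) _) => e.
have [cW _] : {for k1, continuous (top_val e)} /\ {for k1, continuous (top_der e)}.
  by apply: top_continuous => c _; have /andP[_ /lt0r_neq0] := g c.
have /andP[kl W] := g e.
have ckl : {for k1, continuous (fun k : R => k * l e)}.
  by apply: continuousM; [exact: cvg_id|exact: cvg_cst].
near=> k; apply/andP; split; near: k.
  exact: (cvgr_lt _ ckl).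
exact: (cvgr_gt _ cW).
Unshelve. all: by end_near. Qed.

Lemma bad_frequency_root K : 0 < K -> ~ (forall k, 0 < k -> k < K -> good k) ->
  exists k1 e, [/\ 0 < k1, k1 < K, pa e = v, top_val e k1 = 0 &
    forall c, c != e -> 0 < top_val c k1].
Proof.
move=> K0 nK; pose B := [set k | 0 < k < K /\ ~ good k].
have [k2 [/andP[k20 k2K] bk2]] : B !=set0.
  apply/set0P/eqP => B0; apply: nK => k k0 kK; apply: contrapT => bk.
  by have : B k; [split => //; rewrite k0|rewrite B0].
pose D := 1 + \sum_u dist u.
have dD u : dist u <= D.
  rewrite /D (bigD1 u)//= addrCA lerDl addr_ge0// sumr_ge0// => w _; exact: dist_ge0.
have D0 : 0 < D by rewrite ltr_pwDl// sumr_ge0// => w _; exact: dist_ge0.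
(* Any constant below [pi / 2] would serve in place of [pi / 4]; [k0] keeps the infimum of [B] away
   from 0. *)
pose k0 := pi / 4 / D; have k00 : 0 < k0 by rewrite !divr_gt0// pi_gt0.
have small k : 0 < k -> k < k0 -> good k.
  move=> kgt0 kk0; apply: (small_good dD kgt0); apply: (@lt_trans _ _ (pi / 4)).
    by rewrite -ltr_pdivlMr.
  by have := pi_gt0 R; lra.
have Bk2 : B k2 by split => //; rewrite k20.
have Blb : has_lbound B by exists 0 => k [/andP[/ltW]].
pose k1 := inf B.
have k01 : k0 <= k1.
  apply: lb_le_inf; first by exists k2.
  by move=> k [/andP[kg _] bk]; rewrite leNgt; apply/negP => /(small _ kg).
have k10 : 0 < k1 by exact: lt_le_trans k01.
have k12 : k1 <= k2 by apply: ge_inf.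
have k1K : k1 < K by exact: le_lt_trans k2K.
have below k : 0 < k -> k < k1 -> good k.
  move=> kg kk1; apply: contrapT => bk.
  have : k1 <= k by apply: ge_inf => //; split => //; rewrite kg (lt_trans kk1).
  by rewrite leNgt kk1.
(* Goodness is an open condition, so the infimum of the bad frequencies is itself bad. *)
have bk1 : ~ good k1.
  move=> /(good_open k10); rewrite -nbhs_nearE => /nbhs_ballP[e /= e0 ge].
  have [k Bk ke] := inf_adherent e0 (conj (ex_intro _ k2 Bk2) Blb).
  have [_] := Bk; apply; apply: ge; rewrite /ball /= ltr_norml -/k1.
  have : k1 <= k by apply: ge_inf.
  by move: ke; rewrite -/k1 => ? ?; apply/andP; split; lra.
have [e [? ? ?]] := first_bad_frequency k10 below bk1.
by exists k1, e.
Qed.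

Lemma root_zero_system (D : {set V}) k1 e0 :
  (forall w, (w \in D) = (w == v) || [forall c, pa c != w]) ->
  pa e0 = v -> top_val e0 k1 = 0 -> (forall c, c != e0 -> 0 < top_val c k1) ->
  exists A B val, trig_system pa ch l D k1 A B val /\ nontrivial A B.
Proof.
move=> DE e0v W0 Wpos.
(* [X] at the lower end of an edge is the scaling factor of the solution on that edge; dividing by
   [top_val] matches it to the value above. The edge at the root gets the factor 1, because there
   [top_val] is 0. *)
have [X [Xv XE]] := tree_rec_down treeP 0
  (fun e x => if pa e == v then 1 else x / top_val e k1 : R).
pose s e := X (ch e).
have sroot e : pa e = v -> s e = 1 by move=> ev; rewrite /s XE ev eqxx.
have schild c e : pa c = ch e -> s c * top_val c k1 = s e.
  move=> ce; rewrite /s XE ce (negbTE (ch_root treeP e)) divfK// gt_eqF// Wpos//.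
  by apply: contra_eq_neq ce => ->; rewrite e0v eq_sym (ch_root treeP).
exists (fun e => s e * top_val e k1), (fun e => - (s e * top_der e k1)),
  (fun w => if w == v then 0 else X w * [exists c, pa c == w]%:R).
have lowE e : [exists c, pa c == ch e]%:R = low_val e.
  rewrite /low_val /terminal negb_forall; congr (nat_of_bool _)%:R.
  by apply: eq_existsb => c; rewrite negbK.
split.
  split.
  - move=> e; case: eqP => [ev|/eqP ev].
      by rewrite (root_edge ev e0v) W0 mulr0.
    have [ev'|[e' e'e]] := tree_vertexP treeP (pa e); first by rewrite ev' eqxx in ev.
    rewrite (schild _ _ (esym e'e)) -e'e -/(s e').
    have -> : [exists c, pa c == ch e'] by apply/existsP; exists e; rewrite e'e.
    by rewrite mulr1.
  - move=> e; rewrite (negbTE (ch_root treeP e)) lowE -/(s e).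
    have -> : trig k1 (s e * top_val e k1) (- (s e * top_der e k1)) (l e) =
        s e * trig k1 (top_val e k1) (- top_der e k1) (l e).
      by rewrite /trig; ring.
    by rewrite /top_val /top_der trig_rev subrr trig0.
  - move=> w; rewrite DE; case: eqP => //= _ /forallP nw.
    by case: existsP => [[c cw]|]; [have := nw c; rewrite cw|rewrite mulr0].
  - move=> w; rewrite DE negb_or => /andP[wv wc].
    have [wv'|[e ew]] := tree_vertexP treeP w; first by rewrite wv' eqxx in wv.
    have te : ~~ terminal pa ch e by rewrite /terminal ew.
    rewrite -ew (flux_ch treeP).
    have -> : trig k1 (- (s e * top_der e k1)) (- (s e * top_val e k1)) (l e) =
        s e * trig k1 (- top_der e k1) (- top_val e k1) (l e).
      by rewrite /trig; ring.
    have -> : trig k1 (- top_der e k1) (- top_val e k1) (l e) = - low_der e k1.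
      by rewrite /top_val /top_der trig_revD subrr trig0.
    rewrite mulrN opprK {1}/low_der (negbTE te) mulr_sumr -big_split/= big1// => c /eqP ce.
    have Wc : top_val c k1 != 0.
      rewrite gt_eqF// Wpos//; apply: contra_eq_neq ce => ->.
      by rewrite e0v eq_sym (ch_root treeP).
    by rewrite -(schild _ _ ce) qE; field.
exists e0; rewrite W0 mulr0 eqxx /= oppr_eq0 sroot// mul1r.
by apply/eqP => N0; have [a0 b0] := trig_eq0 W0 N0; exact: low_nonzero a0 b0.
Qed.

End Shooting.

(** * The energy comparison *)

Section Jacobi.
Context {R : realType}.
Implicit Types (k a b l d A B al be x : R).

Lemma der_trig_der k A B x :
  is_derive x 1 (trig k B (- A)) (- (k * trig k A B x)).
Proof. by apply: is_derive_eq (der_trig k B (- A) x) _; rewrite trigNN; ring. Qed.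

Lemma trig_zero_itv k A B a b : 0 < k -> a < b ->
  (forall x, x \in `]a, b[ -> trig k A B x = 0) -> A = 0 /\ B = 0.
Proof.
move=> k0 ab t0; pose m := (a + b) / 2.
have mab : m \in `]a, b[ by rewrite in_itv/= midf_lt//= midf_lt.
apply: (@trig_eq0 _ k A B m); first exact: t0.
apply: (mulfI (lt0r_neq0 k0)); rewrite mulr0.
rewrite -(@derive_val _ _ _ _ _ _ _ (der_trig k A B m)) -(@derive_cst _ _ _ (0 : R) m 1).
apply: near_eq_derive.
have : \forall y \near m, y \in `]a, b[ by exact: near_in_itvoo.
by apply: filterS => y /t0.
Qed.

(* Jacobi's identity: [f1 ^+ 2 - k ^+ 2 * f ^+ 2] is the derivative of
   [f ^+ 2 * (w' / w)] plus the square of [f1 - f * (w' / w)]. *)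
Lemma jacobi_le k al be f f1 (T t : R -> R) a b : 0 < k -> a <= b ->
  (forall x, x \in `[a, b] -> 0 < trig k al be x) ->
  derivative_on a b f f1 -> derivative_on a b T t ->
  (forall x, x \in `]a, b[ -> f1 x ^+ 2 - k ^+ 2 * f x ^+ 2 <= t x) ->
  f b ^+ 2 * (k * trig k be (- al) b / trig k al be b) -
  f a ^+ 2 * (k * trig k be (- al) a / trig k al be a) <= T b - T a.
Proof.
move=> k0 ab w0 df dT ft.
pose w := trig k al be; pose w1 x := k * trig k be (- al) x.
pose P x := w1 x / w x.
pose P1 x := - k ^+ 2 - P x ^+ 2.
have dP : derivative_on a b P P1.
  move=> x xab; have wx : w x != 0 by rewrite gt_eqF// w0.
  apply: is_derive_eq (derM (derM (der_cst k x) (der_trig k be (- al) x))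
    (derV wx (der_trig k al be x))) _.
  rewrite trigNN -/(w x) -/(w1 x) /P1 /P -[trig k be (- al) x](mulKf (lt0r_neq0 k0)) -/(w1 x).
  by field; rewrite wx gt_eqF.
pose X x := T x - f x * f x * P x.
pose X1 x := t x - (f x * f x * P1 x + P x * (f x * f1 x + f x * f1 x)).
have dX : derivative_on a b X X1.
  by move=> x xab; exact: derB (dT _ xab) (derM (derM (df _ xab) (df _ xab)) (dP _ xab)).
have X1ge x : x \in `]a, b[ -> 0 <= X1 x.
  move=> xab; have := ft _ xab; rewrite /X1 /P1.
  have := sqr_ge0 (f1 x - f x * P x); nra.
have := @der_ge0_le _ X X1 a b ab dX X1ge.
by rewrite /X /P /w /w1; lra.
Qed.

Definition inner_test kap d A B x := trig kap A B x * sin (kap * (d + x)).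

Definition inner_potential kap d A B x :=
  kap * (trig kap A B x * trig kap B (- A) x +
         trig kap A B x ^+ 2 * sin (2 * (kap * (d + x)))).

(* The derivative of [trig kap A B x / cos (kap * (d + x))] times
   [cos (kap * (d + x)) ^+ 2], which does not depend on [x]. *)
Definition inner_defect kap d A B := kap * (B * cos (kap * d) + A * sin (kap * d)).

(* [f = phi * sin (kap * (d + x))] for a solution [phi] of frequency [kap]. *)
Lemma inner_piece kap k M A B al be d a b : 0 < k -> a <= b ->
  (forall x, trig kap A B x ^+ 2 <= M) -> k <= 2 * kap ->
  (forall x, x \in `[a, b] -> 0 < trig k al be x) ->
  inner_test kap d A B b ^+ 2 * (k * trig k be (- al) b / trig k al be b) -
  inner_test kap d A B a ^+ 2 * (k * trig k be (- al) a / trig k al be a) <=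
  inner_potential kap d A B b - inner_potential kap d A B a -
  inner_defect kap d A B ^+ 2 * (b - a) + ((2 * kap) ^+ 2 - k ^+ 2) * M * (b - a).
Proof.
move=> k0 ab fM kkap w0.
pose f := inner_test kap d A B; pose c := inner_defect kap d A B.
pose T := inner_potential kap d A B; rewrite -/f -/T -/c.
(* The potential belongs to the frequency [2 * kap]. Passing to [k] costs the difference of the
   squared frequencies times [f ^+ 2], which is at most [M]; the [c ^+ 2] is the dropped square. *)
pose K := ((2 * kap) ^+ 2 - k ^+ 2) * M - c ^+ 2.
pose p := trig kap A B; pose p1 := trig kap B (- A).
pose s x := sin (kap * (d + x)); pose co x := cos (kap * (d + x)).
have dr x : is_derive x 1 (fun y => kap * (d + y)) kap.
  by apply: is_derive_eq (derM (der_cst kap x) (derD (der_cst d x) (der_id x))) _; ring.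
have dp x : is_derive x 1 p (kap * p1 x) by exact: der_trig.
have dp1 x : is_derive x 1 p1 (- (kap * p x)) by exact: der_trig_der.
have ds x : is_derive x 1 s (co x * kap) by exact: der_sin.
have dco x : is_derive x 1 co (- s x * kap) by exact: der_cos.
pose f1 x := p x * (co x * kap) + s x * (kap * p1 x).
have df : derivative_on a b f f1 by move=> x _; exact: derM (dp x) (ds x).
pose T2 x := kap * (p x * p1 x + p x * p x * (2 * (s x * co x))) + K * x.
pose t2 x := (2 * kap) ^+ 2 * - f x ^+ 2 + f1 x ^+ 2 + c ^+ 2 + K.
have cE x : c = kap * (p1 x * co x + p x * s x).
  rewrite /c /inner_defect /p /p1 /co /s /trig [kap * (d + x)]mulrDr cosD sinD -[LHS]mul1r -(cos2Dsin2 (kap * x)).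
  by ring.
have sc x : s x ^+ 2 + co x ^+ 2 = 1 by rewrite addrC; exact: cos2Dsin2.
have dT2 : derivative_on a b T2 t2.
  move=> x _.
  apply: is_derive_eq (derD (derM (der_cst kap x) (derD (derM (dp x) (dp1 x))
     (derM (derM (dp x) (dp x)) (derM (der_cst 2 x) (derM (ds x) (dco x))))))
     (derMc K x)) _.
  rewrite /t2 (cE x) /f /f1 /inner_test -/(p x) -/(s x).
  apply/eqP; rewrite -subr_eq0; apply/eqP.
  transitivity (kap ^+ 2 * (p x ^+ 2 - p1 x ^+ 2) * (s x ^+ 2 + co x ^+ 2 - 1)); first ring.
  by rewrite sc subrr mulr0.
have := jacobi_le k0 ab w0 df dT2; rewrite /T2 /K.
have -> : T b = kap * (p b * p1 b + p b * p b * (2 * (s b * co b))).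
  by rewrite /T /inner_potential sin2E -/(p b) -/(p1 b) -/(s b) -/(co b); ring.
have -> : T a = kap * (p a * p1 a + p a * p a * (2 * (s a * co a))).
  by rewrite /T /inner_potential sin2E -/(p a) -/(p1 a) -/(s a) -/(co a); ring.
move=> H; apply: le_trans (H _) _; last by lra.
move=> x _; rewrite /t2 /K.
have : f x ^+ 2 <= M.
  by apply: le_trans (fM x); rewrite /f /inner_test exprMn ler_piMr ?sqr_ge0//.
rewrite -subr_ge0 => fM0; rewrite -subr_ge0.
have -> : (2 * kap) ^+ 2 * - f x ^+ 2 + f1 x ^+ 2 + c ^+ 2 +
    (((2 * kap) ^+ 2 - k ^+ 2) * M - c ^+ 2) - (f1 x ^+ 2 - k ^+ 2 * f x ^+ 2) =
    ((2 * kap) ^+ 2 - k ^+ 2) * (M - f x ^+ 2) by ring.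
rewrite mulr_ge0// subr_ge0 ler_sqr ?nnegrE ?(ltW k0)//; exact: le_trans (ltW k0) kkap.
Qed.

(** An antiderivative of [3 * kap ^+ 2 * phi ^+ 2] in closed form, so that the comparison needs only
    monotonicity and no integrals. *)
Definition outer_loss kap A B x :=
  3 / 2 * (kap ^+ 2 * (A ^+ 2 + B ^+ 2) * x - kap * (trig kap A B x * trig kap B (- A) x)).

Lemma der_outer_loss kap A B x :
  is_derive x 1 (outer_loss kap A B) (3 * kap ^+ 2 * trig kap A B x ^+ 2).
Proof.
have dp1 := der_trig_der kap A B x.
apply: is_derive_eq (derM (der_cst (3 / 2) x) (derB (derMc (kap ^+ 2 * (A ^+ 2 + B ^+ 2)) x)
  (derM (der_cst kap x) (derM (der_trig kap A B x) dp1)))) _.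
by rewrite -(trig_sqr kap A B x); field.
Qed.

Lemma outer_piece kap k M A B al be a b : 0 < k -> a <= b ->
  (forall x, trig kap A B x ^+ 2 <= M) -> k <= 2 * kap ->
  (forall x, x \in `[a, b] -> 0 < trig k al be x) ->
  trig kap A B b ^+ 2 * (k * trig k be (- al) b / trig k al be b) -
  trig kap A B a ^+ 2 * (k * trig k be (- al) a / trig k al be a) <=
  kap * (trig kap A B b * trig kap B (- A) b) -
  kap * (trig kap A B a * trig kap B (- A) a) - (outer_loss kap A B b - outer_loss kap A B a) +
  ((2 * kap) ^+ 2 - k ^+ 2) * M * (b - a).
Proof.
move=> k0 ab fM kkap w0.
pose f := trig kap A B; rewrite -!/(f _).
pose K := ((2 * kap) ^+ 2 - k ^+ 2) * M.
pose p := trig kap A B; pose p1 := trig kap B (- A).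
have dp x : is_derive x 1 p (kap * p1 x) by exact: der_trig.
have dp1 x : is_derive x 1 p1 (- (kap * p x)) by exact: der_trig_der.
have df : derivative_on a b f (fun x => kap * p1 x) by move=> x _; exact: dp.
pose T2 x := kap * (p x * p1 x) - outer_loss kap A B x + K * x.
pose t2 x := kap ^+ 2 * p1 x ^+ 2 - (2 * kap) ^+ 2 * p x ^+ 2 + K.
have dT2 : derivative_on a b T2 t2.
  move=> x _.
  apply: is_derive_eq (derD (derB (derM (der_cst kap x) (derM (dp x) (dp1 x)))
     (der_outer_loss kap A B x)) (derMc K x)) _.
  by rewrite /t2 -/(p x); ring.
have := jacobi_le k0 ab w0 df dT2; rewrite /T2 /K => H.
apply: le_trans (H _) _; last by rewrite /f /p /p1; lra.
move=> x _; rewrite /t2 /K /f -subr_ge0.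
have -> : kap ^+ 2 * p1 x ^+ 2 - (2 * kap) ^+ 2 * p x ^+ 2 +
    ((2 * kap) ^+ 2 - k ^+ 2) * M - ((kap * p1 x) ^+ 2 - k ^+ 2 * trig kap A B x ^+ 2) =
    ((2 * kap) ^+ 2 - k ^+ 2) * (M - p x ^+ 2) by rewrite /p; ring.
rewrite mulr_ge0// subr_ge0 ?fM// ler_sqr ?nnegrE ?(ltW k0)//; exact: le_trans (ltW k0) kkap.
Qed.

End Jacobi.

Section Energy.
Context {R : realType} {V E : finType} {v : V} {pa ch : E -> V} {hop : V -> nat}.
Hypothesis treeP : rooted_tree v pa ch hop.
Variables (l : E -> R) (dist : V -> R).
Hypothesis l_gt0 : forall e, 0 < l e.
Hypothesis dist_root : dist v = 0.
Hypothesis dist_ch : forall e, dist (ch e) = dist (pa e) + l e.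
Variables (D : {set V}) (kap : R) (A B : E -> R) (val : V -> R).
Hypothesis DE : forall w, (w \in D) = (w != v) && [forall c, pa c != w].
Hypothesis kap0 : 0 < kap.
Hypothesis sysP : trig_system pa ch l D kap A B val.

Definition radius u := Num.min (kap * dist u) (pi / 2).
Definition test_val u := val u * sin (radius u).
Definition branch_val u := val u ^+ 2 * sin (2 * radius u).
(* The coordinate on [e] up to which [kap * dist <= pi / 2]. *)
Definition crossing e := Num.max 0 (Num.min (l e) (pi / 2 / kap - dist (pa e))).
Definition loss e :=
  inner_defect kap (dist (pa e)) (A e) (B e) ^+ 2 * crossing e +
  (outer_loss kap (A e) (B e) (l e) - outer_loss kap (A e) (B e) (crossing e)).

Definition low_slope e := trig kap (B e) (- A e) (l e).

Definition edge_energy_bound k e :=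
  kap * (val (ch e) * low_slope e - val (pa e) * B e) +
  kap * (branch_val (ch e) - branch_val (pa e)) - loss e +
  ((2 * kap) ^+ 2 - k ^+ 2) * (A e ^+ 2 + B e ^+ 2) * l e.

Lemma edge_energy e k al be : 0 < k -> k <= 2 * kap ->
  (forall x, x \in `[0, l e] -> 0 < trig k al be x) ->
  test_val (ch e) ^+ 2 * (k * trig k be (- al) (l e) / trig k al be (l e)) -
  test_val (pa e) ^+ 2 * (k * be / al) <= edge_energy_bound k e.
Proof.
move=> k0 kkap w0; have [sysA sysl _ _] := sysP.
have le0 := l_gt0 e; have dc := dist_ch e.
have fM x : trig kap (A e) (B e) x ^+ 2 <= A e ^+ 2 + B e ^+ 2.
  by rewrite -(trig_sqr kap _ _ x) lerDl sqr_ge0.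
have sub a b : 0 <= a -> b <= l e -> forall x, x \in `[a, b] -> 0 < trig k al be x.
  move=> a0 bl x; rewrite in_itv/= => /andP[ax xb]; apply: w0.
  by rewrite in_itv/= (le_trans a0 ax) (le_trans xb bl).
have pivE (y : R) : (y <= pi / 2 / kap) = (kap * y <= pi / 2).
  by rewrite ler_pdivlMr// mulrC.
have [near|far] := leP (kap * dist (ch e)) (pi / 2).
  have nearp : kap * dist (pa e) <= pi / 2.
    by apply: le_trans near; rewrite ler_pM2l// dc lerDl ltW.
  have xE : crossing e = l e.
    rewrite /crossing min_l; first by rewrite max_r// ltW.
    by rewrite lerBrDl -dc pivE.
  have := inner_piece (dist (pa e)) k0 (ltW le0) fM kkap w0.
  rewrite /edge_energy_bound /loss xE /test_val /branch_val /radius !min_l//.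
  rewrite /inner_test /inner_potential !trig0 -dc addr0 sysl -sysA /low_slope.
  by lra.
have [farp|nearp] := leP (pi / 2) (kap * dist (pa e)).
  have xE : crossing e = 0.
    rewrite /crossing max_l// ge_min; apply/orP; right.
    by rewrite subr_le0 ler_pdivrMr// [_ * kap]mulrC.
  have := outer_piece k0 (ltW le0) fM kkap w0.
  rewrite /edge_energy_bound /loss xE /test_val /branch_val /radius !min_r ?(ltW far)//.
  have -> : 2 * (pi / 2) = pi :> R by field.
  rewrite sin_pihalf sinpi !trig0 sysl -sysA /low_slope.
  by lra.
(* The edge is cut where the radius reaches [pi / 2]. The two estimates add up because there the
   sine is 1 and the sine of the doubled radius is 0. *)
pose x0 := pi / 2 / kap - dist (pa e).
have x00 : 0 < x0 by rewrite subr_gt0 ltr_pdivlMr// [_ * kap]mulrC.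
have x0l : x0 < l e by rewrite ltrBlDl -dc ltr_pdivrMr// [_ * kap]mulrC.
have xE : crossing e = x0 by rewrite /crossing -/x0 min_r ?max_r// ltW.
have rx0 : kap * (dist (pa e) + x0) = pi / 2 by rewrite /x0; field; rewrite gt_eqF.
have := inner_piece (dist (pa e)) k0 (ltW x00) fM kkap (sub _ _ (lexx 0) (ltW x0l)).
have := outer_piece k0 (ltW x0l) fM kkap (sub _ _ (ltW x00) (lexx _)).
rewrite /edge_energy_bound /loss xE /test_val /branch_val /radius.
rewrite min_r ?(ltW far)// min_l ?(ltW nearp)//.
rewrite /inner_test /inner_potential !trig0 rx0 addr0.
have -> : 2 * (pi / 2) = pi :> R by field.
by rewrite sin_pihalf sinpi sysl -sysA /low_slope; lra.
Qed.

Variable q : E -> R -> R.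
Hypothesis qE : forall e k, q e k = top_der pa ch l q e k / top_val pa ch l q e k.

(** Sine interpolation: a solution is the combination of [sin (k * (l e - y))] and [sin (k * y)]
    weighted by its end values, and both sines are nonnegative as long as [k * l e < pi]. *)
Lemma low_solution_gt0 e k y : 0 < k -> edge_good pa ch l q e k -> ~~ terminal pa ch e ->
  0 <= y -> y <= l e -> 0 < trig k (low_val pa ch e) (low_der pa ch q e k) y.
Proof.
move=> k0 g te y0 yl; have s0 := edge_good_sin l_gt0 k0 g; have /andP[kl W0] := g.
rewrite -(pmulr_lgt0 _ s0).
have -> : trig k (low_val pa ch e) (low_der pa ch q e k) y * sin (k * l e) =
    low_val pa ch e * sin (k * (l e - y)) + top_val pa ch l q e k * sin (k * y).
  by rewrite /top_val /trig mulrBr sinB; ring.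
rewrite low_val_nonterminal// mul1r.
have siny : 0 <= sin (k * y).
  apply: sin_ge0_pi; rewrite mulr_ge0 ?(ltW k0)//=; apply: le_trans (ltW kl).
  by rewrite ler_pM2l.
move: yl; rewrite le_eqVlt => /predU1P[->|yl].
  by rewrite subrr mulr0 sin0 add0r mulr_gt0.
rewrite ltr_pwDl ?mulr_ge0 ?(ltW W0)//.
apply: sin_gt0_pi; rewrite mulr_gt0 ?subr_gt0//=; apply: le_lt_trans kl.
by rewrite ler_pM2l// gerBl.
Qed.

Lemma edge_energy_good e k : 0 < k -> k <= 2 * kap -> edge_good pa ch l q e k ->
  k * (test_val (pa e) ^+ 2 * q e k - test_val (ch e) ^+ 2 * low_der pa ch q e k) <=
  edge_energy_bound k e.
Proof.
move=> k0 kkap g; have s0 := edge_good_sin l_gt0 k0 g; have /andP[kl W0] := g.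
have [te|te] := boolP (terminal pa ch e); last first.
  (* The energy estimate runs from [pa e] and the shooting from [ch e], so the solution is reversed
     and its slope changes sign. *)
  have := @edge_energy e k (top_val pa ch l q e k) (- top_der pa ch l q e k) k0 kkap.
  have w0 x : x \in `[0, l e] -> 0 < trig k (top_val pa ch l q e k) (- top_der pa ch l q e k) x.
    rewrite in_itv/= => /andP[x0 xl]; rewrite trig_rev.
    by apply: low_solution_gt0 => //; rewrite ?subr_ge0// gerBl.
  move=> /(_ w0); rewrite trig_rev trig_revD subrr !trig0 low_val_nonterminal//.
  by rewrite qE; apply: le_trans; rewrite le_eqVlt; apply/orP; left; apply/eqP; field; rewrite gt_eqF.
have [_ _ sysD _] := sysP.
have val0 : val (ch e) = 0 by apply: sysD; rewrite DE (ch_root treeP).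
rewrite [test_val (ch e)]/test_val val0 mul0r expr0n mul0r subr0.
have qcot : q e k = cos (k * l e) / sin (k * l e).
  rewrite qE /top_der /top_val /trig low_val_terminal//.
  rewrite /low_der te; congr (_ / _); ring.
rewrite -subr_ge0 qcot.
(* The solution vanishes at the leaf, where Jacobi's inequality would divide by 0. For [y < 0] the
   function [sin (k * (l e - x) - y)] has its zero beyond the leaf and is positive on the whole edge
   while [- y < pi - k * l e]. Then [y] tends to 0. *)
pose f y := edge_energy_bound k e -
  k * (test_val (pa e) ^+ 2 * (cos (k * l e - y) / sin (k * l e - y))).
have -> : edge_energy_bound k e -
    k * (test_val (pa e) ^+ 2 * (cos (k * l e) / sin (k * l e))) = f 0.
  by rewrite /f subr0.
have cy : {for (0 : R), continuous (fun y => k * l e - y)}.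
  by apply: continuousB; [exact: cvg_cst|exact: cvg_id].
apply: (@left_limit_ge0 _ f (- (pi - k * l e))).
- by rewrite oppr_lt0 subr_gt0.
- apply: continuousB; first exact: cvg_cst.
  apply: continuousM; first exact: cvg_cst.
  apply: continuousM; first exact: cvg_cst.
  apply: continuousM.
    by apply: continuous_comp cy _; exact: continuous_cos.
  apply: continuousV; first by rewrite subr0 gt_eqF.
  by apply: continuous_comp cy _; exact: continuous_sin.
move=> y; rewrite opprB ltrBlDl => yl y0; rewrite /f subr_ge0.
have := @edge_energy e k (sin (k * l e - y)) (- cos (k * l e - y)) k0 kkap.
have wE x : trig k (sin (k * l e - y)) (- cos (k * l e - y)) x = sin (k * (l e - x) - y).
  have -> : k * (l e - x) - y = k * l e - y - k * x by ring.
  by rewrite [in RHS]sinB /trig; ring.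
have w0 x : x \in `[0, l e] -> 0 < trig k (sin (k * l e - y)) (- cos (k * l e - y)) x.
  rewrite in_itv/= => /andP[x0 xl]; rewrite wE; apply: sin_gt0_pi.
  have kx : 0 <= k * (l e - x) by rewrite mulr_ge0 ?(ltW k0)// subr_ge0.
  have kx2 : k * (l e - x) <= k * l e by rewrite ler_pM2l// gerBl.
  by apply/andP; split; lra.
move=> /(_ w0); rewrite [test_val (ch e)]/test_val val0 mul0r expr0n mul0r sub0r.
apply: le_trans; rewrite le_eqVlt; apply/orP; left; apply/eqP; ring.
Qed.

Definition child_number e : R := \sum_(c | pa c == ch e) 1.

Definition branch_loss e := branch_val (ch e) * (child_number e - 1).

(** The shooting terms cancel: at an inner vertex [low_der] is the sum of [q] over the children, and
    the test function vanishes at the root and at the leaves. Summing [branch_val] over edges leaves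
    its value at each vertex times the number of children minus one. *)
Lemma energy_sum k : 0 < k -> k <= 2 * kap -> good pa ch l q k ->
  \sum_e (kap * branch_loss e + loss e) <=
  ((2 * kap) ^+ 2 - k ^+ 2) * \sum_e (A e ^+ 2 + B e ^+ 2) * l e.
Proof.
move=> k0 kkap g; have [_ _ sysD kirch] := sysP.
have rad0 : radius v = 0.
  by rewrite /radius dist_root mulr0 min_l// divr_ge0// pi_ge0.
have tv0 : test_val v = 0 by rewrite /test_val rad0 sin0 mulr0.
have bv0 : branch_val v = 0 by rewrite /branch_val rad0 mulr0 sin0 mulr0.
have term0 e : terminal pa ch e -> val (ch e) = 0.
  by move=> te; apply: sysD; rewrite DE (ch_root treeP).
have : \sum_e k * (test_val (pa e) ^+ 2 * q e k - test_val (ch e) ^+ 2 * low_der pa ch q e k)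
    <= \sum_e edge_energy_bound k e.
  by apply: ler_sum => e _; exact: edge_energy_good (g e).
rewrite -mulr_sumr sumrB (sum_children treeP (fun e => test_val (pa e) ^+ 2 * q e k)).
rewrite [X in k * (X + _ - _)]big1; last first.
  by move=> c /eqP ->; rewrite tv0 expr0n mul0r.
rewrite add0r -sumrB [X in k * X]big1; last first.
  move=> e _; rewrite (eq_bigr (fun c => test_val (ch e) ^+ 2 * q c k)); last first.
    by move=> c /eqP ->.
  rewrite -mulr_sumr -mulrBr /low_der; case: ifP => te; last by rewrite subrr mulr0.
  by rewrite /test_val term0// mul0r expr0n mul0r.
have -> : \sum_e edge_energy_bound k e =
    kap * (\sum_e (val (ch e) * low_slope e - val (pa e) * B e)) +
    kap * (\sum_e (branch_val (ch e) - branch_val (pa e))) - \sum_e loss e +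
    \sum_e ((2 * kap) ^+ 2 - k ^+ 2) * (A e ^+ 2 + B e ^+ 2) * l e.
  by rewrite !mulr_sumr -sumrN -!big_split.
have -> : \sum_e (kap * branch_loss e + loss e) = kap * (\sum_e branch_loss e) + \sum_e loss e.
  by rewrite mulr_sumr -big_split.
rewrite mulr0.
have -> : \sum_e (val (ch e) * low_slope e - val (pa e) * B e) = 0.
  rewrite -[LHS]opprK -sumrN.
  rewrite (eq_bigr (fun e => val (pa e) * B e - val (ch e) * low_slope e)); last first.
    by move=> e _; rewrite opprB.
  rewrite sum_flux big1 ?oppr0// => w _.
  by have [/sysD ->|/kirch] := boolP (w \in D); [rewrite mul0r|rewrite /low_slope => ->; rewrite mulr0].
have -> : \sum_e (branch_val (ch e) - branch_val (pa e)) = - \sum_e branch_loss e.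
  rewrite sumrB (sum_children treeP (fun e => branch_val (pa e))) [X in _ - (X + _)]big1; last first.
    by move=> c /eqP ->.
  rewrite add0r -sumrB -sumrN; apply: eq_bigr => e _.
  rewrite (eq_bigr (fun=> branch_val (ch e))); last by move=> c /eqP ->.
  have -> : \sum_(c | pa c == ch e) branch_val (ch e) = branch_val (ch e) * child_number e.
    by rewrite mulr_sumr; apply: eq_bigr => c _; rewrite mulr1.
  by rewrite /branch_loss; ring.
have -> : \sum_e ((2 * kap) ^+ 2 - k ^+ 2) * (A e ^+ 2 + B e ^+ 2) * l e =
    ((2 * kap) ^+ 2 - k ^+ 2) * \sum_e (A e ^+ 2 + B e ^+ 2) * l e.
  by rewrite mulr_sumr; apply: eq_bigr => e _; rewrite mulrA.
lra.
Qed.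

Lemma crossing_itv e : 0 <= crossing e /\ crossing e <= l e.
Proof.
by rewrite /crossing le_max lexx/= ge_max (ltW (l_gt0 e)) ge_min lexx.
Qed.

Lemma outer_loss_le e a b : a <= b -> outer_loss kap (A e) (B e) a <= outer_loss kap (A e) (B e) b.
Proof.
move=> ab; apply: (@der_ge0_le _ _ (fun x => 3 * kap ^+ 2 * trig kap (A e) (B e) x ^+ 2) a b ab).
  by move=> x _; exact: der_outer_loss.
move=> x _; apply: mulr_ge0; last exact: sqr_ge0.
by apply: mulr_ge0 => //; exact: sqr_ge0.
Qed.

Lemma loss_ge0 e : 0 <= loss e.
Proof.
have [x0 xl] := crossing_itv e.
apply: addr_ge0; last by rewrite subr_ge0; exact: outer_loss_le.
by apply: mulr_ge0 => //; exact: sqr_ge0.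
Qed.

Lemma radius_itv u : 0 <= radius u <= pi / 2.
Proof.
rewrite /radius le_min ge_min lexx orbT andbT divr_ge0 ?pi_ge0// andbT.
by rewrite mulr_ge0 ?(ltW kap0)// (dist_ge0 treeP l_gt0 dist_root dist_ch).
Qed.

Lemma branch_val_ge0 u : 0 <= branch_val u.
Proof.
have /andP[r0 rpi] := radius_itv u.
rewrite mulr_ge0 ?sqr_ge0// sin_ge0_pi// mulr_ge0//= mulrC -ler_pdivlMr//.
Qed.

Lemma branch_loss_ge0 e : 0 <= branch_loss e.
Proof.
have [_ _ sysD _] := sysP.
have [te|te] := boolP (terminal pa ch e).
  have val0 : val (ch e) = 0 by apply: sysD; rewrite DE (ch_root treeP).
  by rewrite /branch_loss /branch_val val0 expr0n !mul0r.
rewrite mulr_ge0 ?branch_val_ge0// subr_ge0.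
have [c ce] := terminalN te.
by rewrite /child_number (bigD1 c) ?ce//= lerDl sumr_ge0.
Qed.

Lemma no_loss : (forall k, 0 < k -> k < 2 * kap -> good pa ch l q k) ->
  forall e, branch_loss e = 0 /\ loss e = 0.
Proof.
move=> g; pose S := \sum_e (kap * branch_loss e + loss e).
pose C := \sum_e (A e ^+ 2 + B e ^+ 2) * l e.
have S0 e : 0 <= kap * branch_loss e + loss e.
  apply: addr_ge0; last exact: loss_ge0.
  by apply: mulr_ge0; [exact: ltW|exact: branch_loss_ge0].
have : 0 <= ((2 * kap) ^+ 2 - (2 * kap) ^+ 2) * C - S.
  apply: (@left_limit_ge0 _ (fun k => ((2 * kap) ^+ 2 - k ^+ 2) * C - S) 0).
  - by rewrite mulr_gt0.
  - apply: continuousB; last exact: cvg_cst.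
    apply: continuousM; last exact: cvg_cst.
    apply: continuousB; first exact: cvg_cst.
    exact: exprn_continuous.
  - by move=> k k0 kk; rewrite subr_ge0 energy_sum// ?ltW//; exact: g.
rewrite subrr mul0r sub0r oppr_ge0 => Sle.
have /eqP : S = 0 by apply/eqP; rewrite eq_le Sle sumr_ge0.
rewrite psumr_eq0// => /allP S0' e; have := S0' e (mem_index_enum _).
rewrite /= paddr_eq0; last 2 first.
- by apply: mulr_ge0; [exact: ltW|exact: branch_loss_ge0].
- exact: loss_ge0.
rewrite mulf_eq0 gt_eqF//=.
by move=> /andP[/eqP ? /eqP ?].
Qed.

Hypothesis lossless : forall e, branch_loss e = 0 /\ loss e = 0.

Lemma outer_zero e : crossing e < l e -> A e = 0 /\ B e = 0.
Proof.
move=> xl; have [x0 _] := crossing_itv e; apply: (trig_zero_itv kap0 xl) => x xx.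
have [_ /eqP] := lossless e; rewrite /loss paddr_eq0; last 2 first.
- by apply: mulr_ge0 => //; exact: sqr_ge0.
- by rewrite subr_ge0; apply: outer_loss_le; exact: ltW.
move=> /andP[_]; rewrite subr_eq0 => /eqP lx.
have /eqP : 3 * kap ^+ 2 * trig kap (A e) (B e) x ^+ 2 = 0.
  apply: (@der_ge0_eq0 _ (outer_loss kap (A e) (B e))
    (fun x => 3 * kap ^+ 2 * trig kap (A e) (B e) x ^+ 2) (crossing e) (l e)) => //.
  - by move=> y _; exact: der_outer_loss.
  - move=> y _; apply: mulr_ge0; last exact: sqr_ge0.
    by apply: mulr_ge0 => //; exact: sqr_ge0.
  - by rewrite lx.
by rewrite !mulf_eq0 pnatr_eq0 orbb (gt_eqF kap0)/= orbb => /eqP.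
Qed.

Lemma cos_inner u : kap * dist u < pi / 2 -> 0 < cos (kap * dist u).
Proof.
move=> ru; apply: cos_gt0_pihalf; rewrite ru andbT.
apply: (@lt_le_trans _ _ 0); first by rewrite oppr_lt0 divr_gt0 ?pi_gt0.
by rewrite mulr_ge0 ?(ltW kap0)// (dist_ge0 treeP l_gt0 dist_root dist_ch).
Qed.

(** The Wronskian with the cosine vanishes over an inner part of positive length. The cosine is
    nonzero at [pa e], so the slope [B e] is determined. *)
Lemma inner_form e c : kap * dist (pa e) < pi / 2 -> A e = c * cos (kap * dist (pa e)) ->
  forall x, trig kap (A e) (B e) x = c * cos (kap * (dist (pa e) + x)).
Proof.
move=> near Ae x; have [x0 xl] := crossing_itv e.
have x0' : 0 < crossing e.
  by rewrite /crossing lt_max lt_min l_gt0 subr_gt0 ltr_pdivlMr// [_ * kap]mulrC near orbT.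
have [_ /eqP] := lossless e; rewrite /loss paddr_eq0; last 2 first.
- by apply: mulr_ge0 => //; exact: sqr_ge0.
- by rewrite subr_ge0; apply: outer_loss_le.
rewrite mulf_eq0 sqrf_eq0 /inner_defect mulf_eq0 (gt_eqF kap0) (gt_eqF x0')/= orbF.
move=> /andP[/eqP def _]; have c0 := cos_inner near.
have Be : B e = - (c * sin (kap * dist (pa e))).
  apply: (mulIf (lt0r_neq0 c0)); apply/eqP; rewrite -subr_eq0; apply/eqP.
  by rewrite -[RHS]def Ae; ring.
by rewrite mulrDr cosD /trig Ae Be; ring.
Qed.

Lemma inner_val u : kap * dist u < pi / 2 -> val u = val v * cos (kap * dist u).
Proof.
have [sysA sysl _ _] := sysP.
elim/(tree_ind_down treeP): u => [|e IH] near; first by rewrite dist_root mulr0 cos0 mulr1.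
have nearp : kap * dist (pa e) < pi / 2.
  by apply: lt_trans near; rewrite ltr_pM2l// dist_ch ltrDl.
by rewrite -sysl (inner_form nearp (c := val v)) ?dist_ch// sysA IH.
Qed.

Hypothesis AB_nontrivial : nontrivial A B.

Lemma root_val_neq0 : val v != 0.
Proof.
have [sysA _ _ _] := sysP; have [e] := AB_nontrivial; apply: contraTneq => v0.
have [near|far] := ltP (kap * dist (pa e)) (pi / 2).
  have Ae : A e = 0 * cos (kap * dist (pa e)) by rewrite sysA inner_val// v0.
  (* [trig] lives on the whole line, so this point may lie off the edge; there the cosine vanishes
     and [B e] is read off. *)
  have t0 : trig kap (A e) (B e) (pi / 2 / kap) = 0 by rewrite (inner_form near Ae) mul0r.
  have r : kap * (pi / 2 / kap) = pi / 2 by field; rewrite gt_eqF.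
  move: t0; rewrite /trig r cos_pihalf sin_pihalf mulr0 add0r mulr1 => ->.
  by rewrite Ae mul0r eqxx.
have xl : crossing e < l e.
  rewrite /crossing gt_max l_gt0/= gt_min; apply/orP; right.
  apply: le_lt_trans (l_gt0 e); rewrite subr_le0 ler_pdivrMr// [_ * kap]mulrC//.
by have [-> ->] := outer_zero xl; rewrite eqxx.
Qed.

(** An edge crossing radius [pi / 2] would carry the zero solution, contrary to [A e != 0]. If it
    ends before, sin 2r > 0 and the vanishing branch loss leave one child. If it ends exactly there
    and is not terminal, its children carry zero, so the value and, by Kirchhoff, the slope of phi
    vanish at the end, a contradiction again. *)
Lemma inner_edge e : kap * dist (pa e) < pi / 2 ->
  terminal pa ch e \/ kap * dist (ch e) < pi / 2 /\ child_number e = 1.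
Proof.
move=> near; have [sysA sysl sysD kirch] := sysP.
have Ae : A e = val v * cos (kap * dist (pa e)) by rewrite sysA inner_val.
have A0 : A e != 0 by rewrite Ae mulf_neq0 ?root_val_neq0// gt_eqF// cos_inner.
have rl : kap * dist (ch e) <= pi / 2.
  rewrite leNgt; apply/negP => far.
  suff xl : crossing e < l e by have [A0' _] := outer_zero xl; rewrite A0' eqxx in A0.
  rewrite /crossing gt_max l_gt0/= gt_min; apply/orP; right.
  by rewrite ltrBlDl -dist_ch ltr_pdivrMr// [_ * kap]mulrC.
move: rl; rewrite le_eqVlt => /predU1P[rl|rl]; last first.
  right; split => //; have [/eqP + _] := lossless e.
  have vn : val (ch e) != 0 by rewrite inner_val// mulf_neq0 ?root_val_neq0// gt_eqF// cos_inner.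
  rewrite mulf_eq0 mulf_eq0 sqrf_eq0 (negbTE vn)/= subr_eq0 => /orP[|/eqP//].
  rewrite gt_eqF// sin_gt0_pi// /radius min_l ?(ltW rl)//.
  rewrite !mulr_gt0 ?(dist_ch_gt0 treeP l_gt0 dist_root dist_ch)//=.
  by rewrite mulrC -ltr_pdivlMr.
left; apply/negPn/negP => te; have [c ce] := terminalN te.
have ch0 : val (ch e) = 0.
  by rewrite -sysl (inner_form near Ae) -dist_ch rl cos_pihalf mulr0.
have Bc c' : pa c' == ch e -> B c' = 0.
  move=> /eqP c'e; have xl : crossing c' < l c'.
    rewrite /crossing gt_max l_gt0/= gt_min; apply/orP; right.
    apply: le_lt_trans (l_gt0 c'); rewrite subr_le0 ler_pdivrMr// [_ * kap]mulrC.
    by rewrite c'e rl.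
  by have [] := outer_zero xl.
have : flux pa ch B (fun e => trig kap (B e) (- A e) (l e)) (ch e) = 0.
  by apply: kirch; rewrite DE (ch_root treeP).
rewrite (flux_ch treeP) big1// sub0r => /eqP; rewrite oppr_eq0 => /eqP S0.
have [A0' _] : A e = 0 /\ B e = 0.
  by apply: trig_eq0 S0; rewrite sysl ch0.
by rewrite A0' eqxx in A0.
Qed.

Lemma inner_edges e : kap * dist (pa e) < pi / 2.
Proof.
suff H u : kap * dist u < pi / 2 \/ [forall c, pa c != u].
  by have [//|/forallP /(_ e)] := H (pa e); rewrite eqxx.
elim/(tree_ind_down treeP): u => [|e' [near|/forallP /(_ e')]].
- by left; rewrite dist_root mulr0 divr_gt0 ?pi_gt0.
- by have [te|[? _]] := inner_edge near; [right|left].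
- by rewrite eqxx.
Qed.

Lemma lossless_path e c c' : pa c = ch e -> pa c' = ch e -> c = c'.
Proof.
move=> ce c'e; have [/forallP /(_ c)|[_ n1]] := inner_edge (inner_edges e).
  by rewrite ce eqxx.
apply/eqP/negPn/negP => cc'; move: n1.
rewrite /child_number (bigD1 c)/=; last by rewrite ce.
rewrite (bigD1 c')/=; last by rewrite c'e eqxx eq_sym cc'.
move=> /eqP.
by rewrite -subr_eq0 addrAC subrr add0r gt_eqF// ltr_pwDl// sumr_ge0.
Qed.

End Energy.

(** * Trees as rooted trees, and paths *)

Section TreeGraph.
Context {R : realType} (G : metric_graph R) (v : vertex G).

Let adj (a b : vertex G) := [exists e : edge G, ((src e == a) && (tgt e == b))
                                             || ((src e == b) && (tgt e == a))].

(** The ball of radius [n] about [v], so that [hop] becomes the combinatorial distance. *)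
Let reach n : {set vertex G} :=
  iter n (fun S : {set vertex G} => S :|: [set b | [exists a in S, adj a b]])%SET [set v]%SET.

Let reachS n b : (b \in reach n.+1) = (b \in reach n) || [exists a in reach n, adj a b].
Proof. by rewrite /reach iterS !inE. Qed.

Let reach_ex u : exists n, u \in reach n.
Proof.
have /connectP[p] := graph_connected v u.
suff H w n : w \in reach n -> path adj w p -> u = last w p -> exists m, u \in reach m.
  by apply: (H v 0%N); rewrite /reach /= inE.
elim: p w n => [|y p IH] w n wn /=; first by move=> _ ->; exists n.
move=> /andP[wy pp] ul; apply: (IH y n.+1) => //.
by rewrite reachS; apply/orP; right; apply/exists_inP; exists w.
Qed.

Let hop u := ex_minn (reach_ex u).

Let hopP u n : u \in reach n -> (hop u <= n)%N.
Proof. by rewrite /hop; case: ex_minnP => m _ mmin /mmin. Qed.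

Let hop_reach u : u \in reach (hop u).
Proof. by rewrite /hop; case: ex_minnP. Qed.

Let hop_pred u : u != v -> exists2 w, adj w u & hop u = (hop w).+1.
Proof.
move=> uv; have := hop_reach u; case E : (hop u) => [|n].
  by rewrite /reach /= inE (negbTE uv).
rewrite reachS => /orP[/hopP|/exists_inP[w wn wu]]; first by rewrite E ltnn.
exists w => //; congr _.+1; apply/eqP; rewrite eqn_leq (hopP wn) andbT.
have : (hop u <= (hop w).+1)%N.
  by apply: hopP; rewrite reachS; apply/orP; right; apply/exists_inP; exists w.
by rewrite E.
Qed.

(* There are as many edges as non-root vertices, so the edges joining each
   of these to a vertex closer to the root are all the edges. *)
Lemma tree_orientation : is_tree G -> exists (hop : vertex G -> nat) (o : edge G -> bool),
  rooted_tree v (fun e => if o e then src e else tgt e)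
    (fun e => if o e then tgt e else src e) hop.
Proof.
move=> Gt; pose o (e : edge G) := (hop (src e) < hop (tgt e))%N.
exists hop, o.
set pa := fun e => if o e then src e else tgt e.
set ch := fun e => if o e then tgt e else src e.
pose F := [set e | (ch e != v) && (hop (ch e) == (hop (pa e)).+1)]%SET.
have chF : (ch @: F = [set~ v])%SET.
  apply/setP => u; rewrite !inE; apply/imsetP/idP => [[e]|uv].
    by rewrite inE => /andP[ev _] ->.
  have [w /existsP[e /orP[]/andP[/eqP es /eqP et]] hu] := hop_pred uv.
    have oe : o e by rewrite /o es et hu.
    exists e; last by rewrite /ch oe et.
    by rewrite inE /ch /pa oe et es uv hu eqxx.
  have oe : o e = false by rewrite /o es et hu; apply/negbTE; rewrite -leqNgt.
  exists e; last by rewrite /ch oe es.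
  by rewrite inE /ch /pa oe et es uv hu eqxx.
have cF : #|(ch @: F)%SET| = #|edge G|.
  have := cardsC1 v; rewrite chF => ->.
  by have := Gt; rewrite /is_tree => ->.
have FT : F = [set: edge G]%SET.
  apply/eqP; rewrite eqEcard finset.subsetT cardsT -cF; exact: leq_imset_card.
have inF e : e \in F by rewrite FT inE.
split.
- have /imset_injP inj : #|(ch @: F)%SET| == #|F| by rewrite cF FT cardsT.
  by move=> e e' /inj; apply; exact: inF.
- by move=> e; have := inF e; rewrite inE => /andP[].
- move=> u uv; have : u \in (ch @: F)%SET by rewrite chF !inE.
  by move=> /imsetP[e _ ->]; exists e.
- by move=> e; have := inF e; rewrite inE => /andP[_ /eqP].
Qed.

End TreeGraph.

Section Orientation.
Context {R : realType} (G : metric_graph R) (v : vertex G).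
Variables (hop : vertex G -> nat) (o : edge G -> bool).
Let pa e := if o e then src e else tgt e.
Let ch e := if o e then tgt e else src e.
Hypothesis treeP : rooted_tree v pa ch hop.

Lemma degree_oriented w : degree w = (#|[set e | pa e == w]%SET| + #|[set e | ch e == w]%SET|)%N.
Proof.
have cE (f : edge G -> vertex G) : #|[set e | f e == w]%SET| = (\sum_e (f e == w))%N.
  by rewrite -sum1dep_card big_mkcond; apply: eq_bigr => e _; case: (f e == w).
rewrite /degree !cE -!big_split/=; apply: eq_bigr => e _; rewrite /pa /ch.
by case: (o e) => //; rewrite addnC.
Qed.

Lemma leaf_ch e : leaf (ch e) = terminal pa ch e.
Proof.
rewrite /leaf degree_oriented.
have -> : [set e' | ch e' == ch e]%SET = [set e]%SET.
  by apply/finset.setP => e'; rewrite !inE (inj_eq (ch_inj treeP)).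
rewrite cards1 addn1 eqSS cards_eq0; apply/eqP/forallP => [e0 c|te].
  by have /finset.setP/(_ c) := e0; rewrite !inE => ->.
by apply/finset.setP => c; rewrite !inE (negbTE (te c)).
Qed.

Lemma leaf_root : leaf v -> exists2 e0, pa e0 = v & forall e, pa e = v -> e = e0.
Proof.
rewrite /leaf degree_oriented.
have -> : [set e | ch e == v]%SET = finset.set0.
  by apply/finset.setP => e; rewrite !inE (negbTE (ch_root treeP e)).
rewrite cards0 addn0 => /cards1P[e0 e0E]; exists e0.
  by have /finset.setP/(_ e0) := e0E; rewrite !inE eqxx => /eqP.
by move=> e ev; have /finset.setP/(_ e) := e0E; rewrite !inE ev eqxx => /esym/eqP.
Qed.

Lemma leavesE w : leaf v ->
  (w \in leaves G) = (w == v) || [forall c, pa c != w].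
Proof.
move=> vl; rewrite inE; have [->|[e <-]] := tree_vertexP treeP w; first by rewrite eqxx.
by rewrite leaf_ch (negbTE (ch_root treeP e)).
Qed.

Lemma leavesD1E w : (w \in (leaves G :\ v)%SET) = (w != v) && [forall c, pa c != w].
Proof.
rewrite !inE; have [->|[e <-]] := tree_vertexP treeP w; first by rewrite eqxx.
by rewrite leaf_ch.
Qed.

End Orientation.

Section Flip.
Context {R : realType} {V E : finType}.
Variables (s t s' t' : E -> V) (o : E -> bool) (l : E -> R) (D : {set V}) (k : R).
Hypothesis s'E : forall e, s' e = if o e then s e else t e.
Hypothesis t'E : forall e, t' e = if o e then t e else s e.

Lemma trig_system_flip A B val : trig_system s t l D k A B val -> nontrivial A B ->
  exists A' B', trig_system s' t' l D k A' B' val /\ nontrivial A' B'.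
Proof.
move=> [sysA sysl sysD kirch] [e0 AB0].
exists (fun e => if o e then A e else trig k (A e) (B e) (l e)),
       (fun e => if o e then B e else - trig k (B e) (- A e) (l e)); split.
  split.
  - by move=> e; rewrite s'E; case: (o e).
  - by move=> e; rewrite t'E; case: (o e) => //; rewrite trig_rev subrr trig0.
  - exact: sysD.
  - move=> w /kirch; rewrite /flux => kw; rewrite -[RHS]kw; apply: eq_bigr => e _.
    rewrite s'E t'E; case: (o e) => //.
    by rewrite trig_revD subrr trig0; ring.
exists e0; case: (o e0) => //; apply: contraTT AB0.
rewrite !negb_or !negbK oppr_eq0 => /andP[/eqP t0 /eqP t1].
by have [-> ->] := trig_eq0 t0 t1; rewrite eqxx.
Qed.

End Flip.

(** * Trees without branching *)

Section Path.
Context {R : realType} {V E : finType} {v : V} (pa ch : E -> V) {hop : V -> nat}.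
Hypothesis treeP : rooted_tree v pa ch hop.
Variables (l : E -> R) (dist : V -> R).
Hypothesis l_gt0 : forall e, 0 < l e.
Hypothesis dist_root : dist v = 0.
Hypothesis dist_ch : forall e, dist (ch e) = dist (pa e) + l e.
Variable e0 : E.
Hypothesis root_edge : pa e0 = v.
Hypothesis root_unique : forall e, pa e = v -> e = e0.
Hypothesis pathP : forall e c c', pa c = ch e -> pa c' = ch e -> c = c'.

Lemma path_level e e' : hop (pa e) = hop (pa e') -> e = e'.
Proof.
move Eu : (pa e) => u; elim/(tree_ind_down treeP): u e e' Eu => [|f IH] e e' eu hu.
  rewrite (root_unique eu); apply/esym/root_unique.
  have [//|[g ge']] := tree_vertexP treeP (pa e').
  by have := hop_root treeP (pa g); rewrite hu -ge' (hop_ch treeP) ltnn.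
have [e'v|[g ge']] := tree_vertexP treeP (pa e').
  by have := hop_root treeP (pa f); rewrite -e'v -hu (hop_ch treeP) ltnn.
have fg : f = g by apply: IH => //; apply: succn_inj; rewrite -!(hop_ch treeP) ge'.
by apply: (@pathP f) => //; rewrite fg.
Qed.

Lemma terminal_top e e' : terminal pa ch e -> (hop (pa e') <= hop (pa e))%N.
Proof.
move=> te; move Eu : (pa e') => u; elim/(tree_ind_down treeP): u e' Eu => [|f IH] e' eu.
  exact: hop_root treeP _.
rewrite (hop_ch treeP) ltn_neqAle (IH f)// andbT; apply/eqP => /path_level fe.
by move/forallP: te => /(_ e'); rewrite eu fe eqxx.
Qed.

Lemma terminal_unique e e' : terminal pa ch e -> terminal pa ch e' -> e = e'.
Proof.
by move=> te te'; apply: path_level; apply/eqP; rewrite eqn_leq !terminal_top.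
Qed.

(** The equality clause serves the gluing condition: points of different edges at the same distance
    from the root can only meet in a common vertex. *)
Lemma path_dist_le e e' : (hop (pa e) < hop (pa e'))%N ->
  dist (ch e) <= dist (pa e') /\ (dist (ch e) = dist (pa e') -> ch e = pa e').
Proof.
move Eu : (pa e') => u; elim/(tree_ind_down treeP): u e' Eu => [|f IH] e' eu.
  by rewrite ltnNge (hop_root treeP).
rewrite (hop_ch treeP) ltnS leq_eqVlt => /predU1P[/path_level ->//|lt].
have [le _] := IH f erefl lt.
have lt' : dist (ch e) < dist (ch f).
  by apply: le_lt_trans le _; rewrite dist_ch ltrDl.
by split; [exact: ltW|move=> eq; rewrite eq ltxx in lt'].
Qed.

Variable z : E.
Hypothesis z_terminal : terminal pa ch z.

Lemma path_dist_max e : dist (ch e) <= dist (ch z).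
Proof.
have := terminal_top e z_terminal; rewrite leq_eqVlt => /predU1P[/path_level -> //|].
move=> /path_dist_le[le _]; apply: le_trans le _.
by rewrite dist_ch lerDl ltW.
Qed.

Lemma path_cover t : 0 <= t -> t <= dist (ch z) ->
  exists e y, [/\ 0 <= y, y <= l e & dist (pa e) + y = t].
Proof.
move=> t0; have := ch_root treeP z.
elim/(tree_ind_down treeP): (ch z) => [|e IH _ tz]; first by rewrite eqxx.
have [te|te] := leP (dist (pa e)) t.
  exists e, (t - dist (pa e)); split; [by rewrite subr_ge0| |ring].
  by rewrite lerBlDl -dist_ch.
have [ev|[f fe]] := tree_vertexP treeP (pa e).
  by move: te; rewrite ev dist_root ltNge t0.
by apply: IH; [rewrite -fe; exact: ch_root treeP f|exact: ltW].
Qed.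

(** Without branching, the Kirchhoff condition says that the slope is continuous, so a single
    sinusoid in the distance runs through the whole tree. *)
Lemma path_solution (D : {set V}) k A B val : trig_system pa ch l D k A B val ->
  (forall e, ~~ terminal pa ch e -> ch e \notin D) ->
  forall e, A e = trig k (A e0) (B e0) (dist (pa e)) /\
            B e = trig k (B e0) (- A e0) (dist (pa e)).
Proof.
move=> [sysA sysl _ kirch] nD e; move Eu : (pa e) => u.
elim/(tree_ind_down treeP): u e Eu => [|f IH] e eu.
  by rewrite (root_unique eu) dist_root !trig0.
have [Af Bf] := IH f erefl; rewrite dist_ch.
split; first by rewrite sysA eu -sysl Af Bf trig_shift.
have tf : ~~ terminal pa ch f.
  by rewrite negb_forall; apply/existsP; exists e; rewrite eu eqxx.
have := kirch _ (nD _ tf); rewrite (flux_ch treeP) (big_pred1 e); last first.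
  by move=> c /=; apply/eqP/eqP => [ce|->//]; exact: pathP ce eu.
by move=> /eqP; rewrite subr_eq0 => /eqP ->; rewrite Af Bf trig_shiftD.
Qed.

Lemma path_system (D : {set V}) k al be :
  (forall w, w \in D -> trig k al be (dist w) = 0) ->
  (forall e, terminal pa ch e -> ch e \in D) -> (v \notin D -> be = 0) ->
  trig_system pa ch l D k (fun e => trig k al be (dist (pa e)))
    (fun e => trig k be (- al) (dist (pa e))) (fun u => trig k al be (dist u)).
Proof.
move=> D0 tD vD; split => //.
  by move=> e; rewrite trig_shift dist_ch.
move=> w wD; have [wv|[e ew]] := tree_vertexP treeP w.
  rewrite wv (flux_root treeP) (big_pred1 e0); last first.
    by move=> c /=; apply/eqP/eqP => [/root_unique|->].
  by rewrite root_edge dist_root trig0 vD// -wv.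
have te : ~~ terminal pa ch e by apply: contra wD => /tD; rewrite ew.
have [c ce] := terminalN te.
rewrite -ew (flux_ch treeP) (big_pred1 c); last first.
  by move=> c' /=; apply/eqP/eqP => [c'e|->//]; exact: pathP c'e ce.
by rewrite ce trig_shiftD -dist_ch subrr.
Qed.

End Path.

(** * The frequencies of a tree *)

Section Interval.
Context {R : realType} (G : metric_graph R) (v : vertex G).
Variables (hop : vertex G -> nat) (o : edge G -> bool).
Let pa e := if o e then src e else tgt e.
Let ch e := if o e then tgt e else src e.
Hypothesis treeP : rooted_tree v pa ch hop.
Variable dist : vertex G -> R.
Hypothesis dist_root : dist v = 0.
Hypothesis dist_ch : forall e, dist (ch e) = dist (pa e) + len e.
Variable e0 : edge G.
Hypothesis root_edge : pa e0 = v.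
Hypothesis root_unique : forall e, pa e = v -> e = e0.

Let coord (e : edge G) (x : R) : R := if o e then x else len e - x.

Let coordK e : involutive (coord e).
Proof. by move=> x; rewrite /coord; case: (o e) => //; rewrite subKr. Qed.

Let coord_itv e x : (x \in `[0, len e]) = (0 <= coord e x <= len e).
Proof.
rewrite in_itv/= /coord; case: (o e) => //.
by rewrite subr_ge0 gerBl andbC.
Qed.

Let coord_pa e : endpoint e (coord e 0) (pa e).
Proof.
rewrite /coord /pa; case: (o e); first exact: endpoint_src.
by rewrite subr0; exact: endpoint_tgt.
Qed.

Let coord_ch e : endpoint e (coord e (len e)) (ch e).
Proof.
rewrite /coord /ch; case: (o e); first exact: endpoint_tgt.
by rewrite subrr; exact: endpoint_src.
Qed.

Lemma path_interval : (forall e c c', pa c = ch e -> pa c' = ch e -> c = c') ->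
  forall z, terminal pa ch z -> graph_is_interval G.
Proof.
move=> pathP z tz; have l0 := @len_gt0 R G.
pose phi e x := dist (pa e) + coord e x.
have phi_endpoint e x w : endpoint e x w -> phi e x = dist w.
  have := dist_ch e; rewrite /phi /coord /pa /ch => d.
  case=> -[-> <-]; case: (o e) d => d.
  - by rewrite addr0.
  - by rewrite subr0 d.
  - by rewrite d.
  - by rewrite subrr addr0.
have dz := dist_ch_gt0 treeP l0 dist_root dist_ch z.
exists (dist (ch z)), phi; split => //.
- move=> e x y _ _; rewrite /phi /coord; case: (o e).
    by congr `|_|; ring.
  by rewrite -normrN; congr `|_|; ring.
- move=> e e' x x' xe xe'; split; last first.
    by move=> [[<- <-]//|[w [/phi_endpoint -> /phi_endpoint ->]]].
  wlog lt : e e' x x' xe xe' / (hop (pa e) < hop (pa e'))%N.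
    move=> H eq; case: (ltngtP (hop (pa e)) (hop (pa e'))) => lt.
    + exact: H.
    + have [[-> ->]|[w [? ?]]] := H e' e x' x xe' xe lt (esym eq); first by left.
      by right; exists w.
    + have ee' := path_level treeP root_unique pathP lt; left; split=> //.
      move: eq; rewrite /phi -ee' => /addrI eq.
      by rewrite -[x](coordK e) eq coordK.
  have [le eqch] := path_dist_le treeP l0 dist_ch root_unique pathP lt.
  move: xe xe'; rewrite !coord_itv => /andP[x0 xl] /andP[x0' xl'] eq.
  have dc := dist_ch e; rewrite /phi in eq.
  have xE : coord e x = len e by lra.
  have xE' : coord e' x' = 0 by lra.
  right; exists (ch e); split.
    by rewrite -[x](coordK e) xE; exact: coord_ch.
  by rewrite -[x'](coordK e') xE' eqch; [exact: coord_pa|lra].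
- move=> t; rewrite in_itv/=; split.
    move=> /andP[t0 tz'].
    have [e [y [y0 yl yt]]] := path_cover treeP dist_root dist_ch t0 tz'.
    exists e, (coord e y); rewrite coord_itv /phi coordK y0 yl; split => //.
  move=> [e [x [+ <-]]]; rewrite coord_itv /phi => /andP[x0 xl].
  have d0 := dist_ge0 treeP l0 dist_root dist_ch (pa e).
  have dm := path_dist_max treeP l0 dist_ch root_unique pathP tz e.
  by have dc := dist_ch e; apply/andP; split; lra.
Qed.

(* Near a vertex, three edges would have to go in the two directions of a line. *)
Lemma interval_path : graph_is_interval G ->
  forall e c c', pa c = ch e -> pa c' = ch e -> c = c'.
Proof.
move=> [L [phi [_ iso glue _]]] e c c' ce c'e; apply: contrapT => cc'.
(* Half of the shortest length, so that the points at distance [eps] from the vertex are interior to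
   their edges and cannot be identified with each other. *)
pose eps := Num.min (len e) (Num.min (len c) (len c')) / 2.
have eps0 : 0 < eps by rewrite divr_gt0// !lt_min !len_gt0.
have epsl f : f \in [:: e; c; c'] -> eps < len f.
  have l0 := len_gt0 f; move=> fin; rewrite /eps ltr_pdivrMr//.
  apply: (@le_lt_trans _ _ (len f)); last by rewrite ltr_pMr// ltr1n.
  by move: fin; rewrite !inE => /or3P[]/eqP ->; rewrite !ge_min lexx ?orbT.
have far f a w : f \in [:: e; c; c'] -> endpoint f a w -> exists x,
    [/\ x \in `[0, len f], `|phi f x - phi f a| = eps & x != 0 /\ x != len f].
  move=> fin fa; have el := epsl f fin; have l0 := len_gt0 f.
  have ain := endpoint_edge fa.
  case: fa => -[aE _].
    exists eps; have xin : eps \in `[0, len f] by rewrite in_itv/= !ltW.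
    split => //; last by rewrite gt_eqF// lt_eqF.
    by rewrite iso// aE subr0 gtr0_norm.
  exists (len f - eps); have xin : len f - eps \in `[0, len f].
    by rewrite in_itv/= subr_ge0 gerBl !ltW.
  split => //; last by rewrite gt_eqF ?subr_gt0// lt_eqF// gtrBl.
  by rewrite iso// aE addrAC subrr add0r normrN gtr0_norm.
have inner f x f' x' : f != f' -> x \in `[0, len f] -> x' \in `[0, len f'] ->
    x != 0 /\ x != len f -> phi f x <> phi f' x'.
  move=> ff' xin xin' [x0 xl] /(glue _ _ _ _ xin xin')[[ee _]|[w [[[xe _]|[xe _]] _]]].
  - by rewrite ee eqxx in ff'.
  - by rewrite xe eqxx in x0.
  - by rewrite xe eqxx in xl.
have ew := coord_ch e.
have cw := coord_pa c; rewrite ce in cw; have c'w := coord_pa c'; rewrite c'e in c'w.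
have same f f' a a' : endpoint f a (ch e) -> endpoint f' a' (ch e) -> phi f a = phi f' a'.
  move=> fa fa'; apply/(glue _ _ _ _ (endpoint_edge fa) (endpoint_edge fa')).
  by right; exists (ch e).
have [|x [xin xd xn]] := far e _ _ _ ew; first by rewrite !inE eqxx.
have [|y [yin yd yn]] := far c _ _ _ cw; first by rewrite !inE eqxx orbT.
have [|y' [y'in y'd y'n]] := far c' _ _ _ c'w; first by rewrite !inE eqxx !orbT.
rewrite (same _ _ _ _ cw ew) in yd; rewrite (same _ _ _ _ c'w ew) in y'd.
have ne (f f' : edge G) : pa f' = ch f -> f != f'.
  move=> f'f; apply/eqP => ff'; have := hop_ch treeP f.
  by rewrite -f'f ff' => /n_Sn.
have n1 := inner _ _ _ _ (ne _ _ ce) xin yin xn.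
have n2 := inner _ _ _ _ (ne _ _ c'e) xin y'in xn.
have cc'b : c != c' by apply/eqP.
have n3 := inner _ _ _ _ cc'b yin y'in yn.
set p := phi e (coord e (len e)) in xd yd y'd.
(* Three distinct points would have to occupy two positions. *)
have two (r : R) : `|r - p| = eps -> r = p + eps \/ r = p - eps.
  by case: (ger0P (r - p)) => _ <-; [left|right]; ring.
case: (two _ xd) n1 n2 => -> n1 n2; case: (two _ yd) n1 n3 => -> n1 n3;
  by case: (two _ y'd) n2 n3 => -> n2 n3.
Qed.

End Interval.

Definition first_frequency {R : realType} {V E : finType} (s t : E -> V) (l : E -> R)
    (D : {set V}) (k : R) :=
  [/\ 0 < k, exists A B val, trig_system s t l D k A B val /\ nontrivial A B &
    forall k' A B val, 0 < k' -> trig_system s t l D k' A B val -> nontrivial A B -> k <= k'].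

Lemma first_eigenvalue_frequency (R : realType) (G : metric_graph R) (s t : edge G -> vertex G)
    (o : edge G -> bool) (D : {set vertex G}) (w : vertex G) (mu : R) :
  (forall e, s e = if o e then src e else tgt e) ->
  (forall e, t e = if o e then tgt e else src e) ->
  w \in D -> graph_first_eigenvalue D mu ->
  exists2 k, mu = k ^+ 2 & first_frequency s t len D k.
Proof.
move=> sE tE wD [ev mumin].
have srcE e : src e = if o e then s e else t e by rewrite sE tE; case: (o e).
have tgtE e : tgt e = if o e then t e else s e by rewrite sE tE; case: (o e).
have Dn : exists w, w \in D by exists w.
have [k [A [B [val [k0 kE sys nt]]]]] := eigenvalue_system Dn ev.
have [A' [B' [sys' nt']]] := trig_system_flip sE tE sys nt.
exists k => //; split => //; first by exists A', B', val.
move=> k1 A1 B1 val1 k10 sys1 nt1.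
have [A2 [B2 [sys2 nt2]]] := trig_system_flip srcE tgtE sys1 nt1.
have := mumin _ (system_eigenvalue sys2 k10 nt2).
by rewrite kE ler_sqr ?nnegrE ?(ltW k0) ?(ltW k10).
Qed.

(** * Comparison of the two frequencies *)

Section Ratio.
Context {R : realType} {V E : finType} {v : V} (pa ch : E -> V) {hop : V -> nat}.
Hypothesis treeP : rooted_tree v pa ch hop.
Variables (l : E -> R) (dist : V -> R).
Hypothesis l_gt0 : forall e, 0 < l e.
Hypothesis dist_root : dist v = 0.
Hypothesis dist_ch : forall e, dist (ch e) = dist (pa e) + l e.
Variable e0 : E.
Hypothesis root_edge : pa e0 = v.
Hypothesis root_unique : forall e, pa e = v -> e = e0.
Variables (Dl Dt : {set V}) (kl kt : R).
Hypothesis DlE : forall w, (w \in Dl) = (w == v) || [forall c, pa c != w].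
Hypothesis DtE : forall w, (w \in Dt) = (w != v) && [forall c, pa c != w].
Hypothesis klP : first_frequency pa ch l Dl kl.
Hypothesis ktP : first_frequency pa ch l Dt kt.

Lemma tree_terminal : E -> exists z, terminal pa ch z.
Proof.
move=> e; have [z _ zmax] := @arg_maxnP _ e predT (fun e => hop (ch e)) isT.
exists z; apply/forallP => c; apply/eqP => cz.
by have := zmax c isT; rewrite /geq /= (hop_ch treeP c) cz ltnn.
Qed.

Lemma path_end_condition z (D : {set V}) k A B val :
  (forall e c c', pa c = ch e -> pa c' = ch e -> c = c') ->
  trig_system pa ch l D k A B val -> nontrivial A B ->
  ch z \in D -> (forall e, ~~ terminal pa ch e -> ch e \notin D) ->
  trig k (A e0) (B e0) (dist (ch z)) = 0 /\ ((A e0 != 0) || (B e0 != 0)).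
Proof.
move=> pathP sys [e1 n1] zD nD.
have sol := path_solution treeP dist_root dist_ch root_unique pathP sys nD.
have [_ sysl sysD _] := sys; split.
  rewrite -(sysD _ zD) -sysl; have [-> ->] := sol z.
  by rewrite trig_shift -dist_ch.
apply: contraTT n1; rewrite !negb_or !negbK => /andP[/eqP a0 /eqP b0].
by have [-> ->] := sol e1; rewrite a0 b0 oppr0 /trig !mul0r addr0 eqxx.
Qed.

(** With [L] the total length, cos (kt L) = 0 gives sin (2 kt L) = 0, so [2 * kt] is a Dirichlet
    frequency and [kl <= 2 * kt]. Conversely sin (kl L) = 0 forces [pi <= kl * L], while
    [pi / 2 / L] is a mixed frequency and thus bounds [kt] from above. *)
Lemma path_frequency z : terminal pa ch z ->
  (forall e c c', pa c = ch e -> pa c' = ch e -> c = c') -> kl = 2 * kt.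
Proof.
move=> tz pathP; set L := dist (ch z).
have L0 : 0 < L := dist_ch_gt0 treeP l_gt0 dist_root dist_ch z.
have tE e : terminal pa ch e -> e = z.
  by move=> te; exact: (terminal_unique treeP root_unique pathP te tz).
have zDt : ch z \in Dt by rewrite DtE (ch_root treeP).
have zDl : ch z \in Dl by rewrite DlE; apply/orP; right.
have [kt0 [A [B [val [sys nt]]]] ktmin] := ktP.
have [kl0 [A1 [B1 [val1 [sys1 nt1]]]] klmin] := klP.
apply/eqP; rewrite eq_le; apply/andP; split.
  have [|b0 a0] := path_end_condition pathP sys nt zDt.
    by move=> e te; rewrite DtE (ch_root treeP).
  have vDt : v \notin Dt by rewrite DtE eqxx.
  have B0 : B e0 = 0.
    have [_ _ _ kirch] := sys; have := kirch _ vDt.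
    rewrite (flux_root treeP) (big_pred1 e0)// => c /=.
    by apply/eqP/eqP => [/root_unique|->].
  move: b0 a0; rewrite B0 eqxx orbF /trig mul0r addr0 => /eqP + A0.
  rewrite mulf_eq0 (negbTE A0)/= => /eqP cosL.
  apply: (klmin _ (fun e => trig (2 * kt) 0 1 (dist (pa e)))
    (fun e => trig (2 * kt) 1 (- 0) (dist (pa e))) (fun u => trig (2 * kt) 0 1 (dist u))).
  - by rewrite mulr_gt0.
  - apply: (path_system treeP dist_root dist_ch root_edge root_unique pathP).
    + move=> w; rewrite DlE => /orP[/eqP ->|]; first by rewrite dist_root trig0.
      have [->|[e <-]] := tree_vertexP treeP w; first by rewrite dist_root trig0.
      move=> /tE ->; rewrite /trig mul0r add0r mul1r -mulrA sin2E -/L cosL.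
      by rewrite !mulr0.
    + by move=> e te; rewrite DlE; apply/orP; right.
    + by rewrite DlE eqxx.
  - exists e0; apply/orP; right.
    by rewrite root_edge dist_root trig0 oner_neq0.
have [|s0 nz] := path_end_condition pathP sys1 nt1 zDl.
  by move=> e te; rewrite DlE (negbTE (ch_root treeP e)).
have A0 : A1 e0 = 0.
  by have [sysA _ sysD _] := sys1; rewrite sysA root_edge sysD// DlE eqxx.
move: s0 nz; rewrite A0 eqxx /= /trig mul0r add0r => /eqP + B0.
rewrite mulf_eq0 (negbTE B0)/= => /eqP sinL.
have klpi : pi <= kl * L.
  rewrite leNgt; apply/negP => lt; have := sin_gt0_pi (x := kl * L).
  by rewrite mulr_gt0//= lt sinL ltxx => /(_ isT).
have kt_le : kt <= pi / 2 / L.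
  apply: (ktmin _ (fun e => trig (pi / 2 / L) 1 0 (dist (pa e)))
    (fun e => trig (pi / 2 / L) 0 (- 1) (dist (pa e))) (fun u => trig (pi / 2 / L) 1 0 (dist u))).
  - by rewrite !divr_gt0 ?pi_gt0.
  - apply: (path_system treeP dist_root dist_ch root_edge root_unique pathP) => //.
    + move=> w; rewrite DtE => /andP[wv].
      have [wv'|[e <-]] := tree_vertexP treeP w; first by rewrite wv' eqxx in wv.
      move=> /tE ->; rewrite /trig mul0r addr0 mul1r divfK ?cos_pihalf//.
      by rewrite gt_eqF.
    + by move=> e te; rewrite DtE (ch_root treeP).
  - exists e0; apply/orP; left.
    by rewrite root_edge dist_root trig0 oner_neq0.
apply: (@le_trans _ _ (2 * (pi / 2 / L))); first by rewrite ler_pM2l.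
have -> : 2 * (pi / 2 / L) = pi / L by field; rewrite gt_eqF.
by rewrite ler_pdivrMr.
Qed.

Lemma branching_frequency :
  ~ (forall e c c', pa c = ch e -> pa c' = ch e -> c = c') -> kl < 2 * kt.
Proof.
move=> npath; have [kt0 [A [B [val [sys nt]]]] _] := ktP.
have [_ _ klmin] := klP.
(* The recursion produces functions of the frequency, so that one [q] serves all [k] and can be
   examined as [k] varies. *)
have [|q qE] := tree_rec_up treeP (fun=> 0 : R) (F := fun e f k =>
    let be := if terminal pa ch e then 1 else \sum_(c | pa c == ch e) f c k in
    trig k be (- low_val pa ch e) (l e) / trig k (low_val pa ch e) be (l e)).
  move=> e f g fg; apply/funext => k /=.
  suff -> : \sum_(c | pa c == ch e) f c k = \sum_(c | pa c == ch e) g c k by [].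
  by apply: eq_bigr => c /eqP /fg ->.
have {}qE e k : q e k = top_der pa ch l q e k / top_val pa ch l q e k.
  by rewrite qE.
have kt20 : 0 < 2 * kt by rewrite mulr_gt0.
have [gd|bad] := pselect (forall k, 0 < k -> k < 2 * kt -> good pa ch l q k).
  have nl := no_loss treeP l_gt0 dist_root dist_ch DtE kt0 sys qE gd.
  exfalso; apply: npath.
  exact: (lossless_path treeP l_gt0 dist_root dist_ch DtE kt0 sys nl nt).
have ru e c : pa e = v -> pa c = v -> e = c.
  by move=> /root_unique -> /root_unique ->.
have [k1 [e [k10 k1K ev W0 Wpos]]] :=
  bad_frequency_root treeP l_gt0 dist_root dist_ch qE ru kt20 bad.
have [A1 [B1 [val1 [sys1 nt1]]]] := root_zero_system treeP qE ru DlE ev W0 Wpos.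
exact: (le_lt_trans (klmin _ _ _ _ k10 sys1 nt1) k1K).
Qed.

End Ratio.

Theorem theorem1p3 (R : realType) (G : metric_graph R) (v : vertex G)
    (lambda1 tau1 : R)
    (G_tree : is_tree G) (v_leaf : leaf v)
    (lambda1P : graph_first_eigenvalue (leaves G) lambda1)
    (tau1P : graph_first_eigenvalue (leaves G :\ v)%SET tau1) :
  lambda1 / tau1 <= 4 /\ (lambda1 / tau1 = 4 <-> graph_is_interval G).
Proof.
have [hop [up treeP]] := tree_orientation v G_tree.
have DlE w := leavesE treeP w v_leaf.
have DtE := leavesD1E treeP.
have [e0 root_edge root_unique] := leaf_root treeP v_leaf.
have [dist [dist_root dist_ch]] := tree_rec_down treeP 0 (fun e x => x + len e : R).
have [z tz] := tree_terminal treeP e0.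
have vDl : v \in leaves G by rewrite DlE eqxx.
have zDt : (if up z then tgt z else src z) \in (leaves G :\ v)%SET.
  by rewrite DtE (ch_root treeP z); exact: tz.
have pE e : (if up e then src e else tgt e) = if up e then src e else tgt e by [].
have cE e : (if up e then tgt e else src e) = if up e then tgt e else src e by [].
have [kl -> klP] := first_eigenvalue_frequency pE cE vDl lambda1P.
have [kt -> ktP] := first_eigenvalue_frequency pE cE zDt tau1P.
have kl0 : 0 < kl by case: klP.
have kt0 : 0 < kt by case: ktP.
have fourE : kl ^+ 2 / kt ^+ 2 = 4 * (kl / (2 * kt)) ^+ 2 by field; rewrite gt_eqF.
rewrite fourE.
have [pathP|npath] := pselect (forall e c c' : edge G,
    (if up c then src c else tgt c) = (if up e then tgt e else src e) ->
    (if up c' then src c' else tgt c') = (if up e then tgt e else src e) -> c = c').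
  have -> := path_frequency treeP (@len_gt0 R G) dist_root dist_ch root_edge root_unique
    DlE DtE klP ktP tz pathP.
  rewrite divff ?expr1n ?mulr1; last by rewrite gt_eqF// mulr_gt0.
  split=> //; split=> // _.
  exact: (path_interval treeP dist_root dist_ch root_unique pathP tz).
have lt := branching_frequency treeP (@len_gt0 R G) dist_root dist_ch (e0 := e0)
  root_unique DlE DtE klP ktP npath.
have lt1 : (kl / (2 * kt)) ^+ 2 < 1.
  by rewrite expr_lt1 ?divr_ge0 ?mulr_ge0 ?ltW// ltr_pdivrMr ?mul1r ?mulr_gt0.
split; first by rewrite ltW// gtr_pMr.
split=> [eq|/(interval_path treeP)//].
by move: lt1; rewrite -(ltr_pM2l (ltr0n R 4)) eq mulr1 ltxx.
Qed.
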